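(* Let $n\ge2$ and let $\mathcal{F}=\{f_1,\ldots,f_n\}$, $f_i\in(\mathbb{C}^* )^{A_i}$, be a generic collection of Laurent polynomials with $\mathcal{I}(\mathcal{F})$ compact, and let $K$ be a connected component of $\mathcal{I}(\mathcal{F})$. Then the vertex set of the polytope $P_K$ is the set of extreme points of $\mathrm{conv}(K)$. In particular, $\mathrm{conv}(K)=P_K$.
   Context: Amoeba $\mathcal{A}(f)=\mathrm{Log}|\mathcal{V}(f)|\subseteq\mathbb{R}^n$ with $\mathrm{Log}|(z_1,\ldots,z_n)|=(\log|z_1|,\ldots,\log|z_n|)$; $(\mathbb{C}^* )^A$ = Laurent polynomials with support exactly $A\subseteq\mathbb{Z}^n$. Components of $\mathbb{R}^n\setminus\mathcal{A}(f)$ are convex; $E_\alpha(f)$ denotes the component whose order (value of the order map $\mathbf{w}\mapsto\big(\frac{1}{(2\pi i)^n}\int_{\mathrm{Log}|\mathbf{z}|=\mathbf{w}}\frac{z_j\partial_jf}{f}\frac{dz_1\cdots dz_n}{z_1\cdots z_n}\big)_j$) is $\alpha$. Genericity: (1) each $f_j$ irreducible; (2) for every $k$-subset $\{f_{i_1},\ldots,f_{i_k}\}$, $\bigcap_\ell\partial\mathcal{A}(f_{i_\ell})$ has codimension $k$; (3) for every $p\in\bigcap_j\mathcal{A}(f_j)$ and $\ell$ with $p\in\partial\mathcal{A}(f_\ell)$, a unique component of $\mathbb{R}^n\setminus\mathcal{A}(f_\ell)$ contains $p$ in its closure. $\mathcal{I}(\mathcal{F})=\bigcap_j\mathcal{A}(f_j)$;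 $V(\mathcal{F})=\bigcap_j\partial\mathcal{A}(f_j)$; for a connected component $K$ of $\mathcal{I}(\mathcal{F})$, $V(K)=K\cap V(\mathcal{F})$ and $P_K=\mathrm{conv}(V(K))$ (the intersection polytope). *)

(* Defs.v *)
From HB Require Import structures.
From mathcomp Require Import all_boot all_order all_algebra finmap.
From mathcomp Require Import all_classical all_reals all_analysis.
From mathcomp Require Import complex.

Set Implicit Arguments.
Unset Strict Implicit.
Unset Printing Implicit Defensive.

Import Order.TTheory GRing.Theory Num.Theory.
Import numFieldNormedType.Exports.

Local Open Scope classical_set_scope.
Local Open Scope ring_scope.

(* [f a] is the coefficient of the monomial z^a, and [finsupp f] is the
   support of f. *)
Definition laurent (R : realType) (n : nat) : Type :=
  {fsfun 'rV[int]_n -> R[i] with 0}.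

Definition laurent_one (R : realType) (n : nat) : laurent R n :=
  [fsfun a in [fset (0 : 'rV[int]_n)]%fset => (1 : R[i])].

Definition laurent_mul (R : realType) (n : nat) (f g : laurent R n) :
    laurent R n :=
  [fsfun c in [fset (a + b)%R | a in finsupp f, b in finsupp g]%fset =>
    \sum_(a <- finsupp f) f a * g (c - a)].

Definition laurent_unit (R : realType) (n : nat) (f : laurent R n) : Prop :=
  exists g : laurent R n, laurent_mul f g = laurent_one R n.

(* Zero is excluded: 0 = 0 * 0 and 0 is not a unit. *)
Definition laurent_irreducible (R : realType) (n : nat) (f : laurent R n) :
    Prop :=
  ~ laurent_unit f /\
  forall g h : laurent R n,
    f = laurent_mul g h -> laurent_unit g \/ laurent_unit h.

Definition laurent_eval (R : realType) (n : nat) (f : laurent R n)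
    (z : 'rV[R[i]]_n) : R[i] :=
  \sum_(a <- finsupp f) f a * \prod_(i < n) z 0 i ^ a 0 i.

Definition torus_variety (R : realType) (n : nat) (f : laurent R n) :
    set 'rV[R[i]]_n :=
  [set z : 'rV[R[i]]_n | (forall i, z 0 i != 0) /\ laurent_eval f z = 0].

Definition Log_abs (R : realType) (n : nat) (z : 'rV[R[i]]_n) : 'rV[R]_n :=
  \row_i ln (Normc.normc (z 0 i)).

Definition amoeba (R : realType) (n : nat) (f : laurent R n) :
    set 'rV[R]_n :=
  @Log_abs R n @` torus_variety f.

Definition boundary (T : topologicalType) (S : set T) : set T :=
  closure S `\` interior S.

Definition is_component (T : topologicalType) (S C : set T) : Prop :=
  exists2 x, S x & C = connected_component S x.

(* Infimum of the sums of the r_k ^ s over countable covers by balls of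
   positive radius r_k.  The balls are those of the max norm; this changes the
   content by at most a constant factor, hence not the dimension. *)
Definition hausdorff_content (R : realType) (n : nat) (s : R)
    (S : set 'rV[R]_n) : \bar R :=
  ereal_inf [set v | exists c : nat -> 'rV[R]_n, exists r : nat -> R,
    [/\ forall k, 0 < r k,
        S `<=` \bigcup_k ball (c k) (r k)
      & v = (\sum_(0 <= k <oo) (r k `^ s)%:E)%E]].

Definition hausdorff_dim (R : realType) (n : nat) (S : set 'rV[R]_n) : \bar R :=
  ereal_inf [set s%:E | s in [set s : R |
    0 <= s /\ hausdorff_content s S = 0%E]].

(* As usual for intersections, the empty set has every codimension.  For the
   sets considered here (images under Log of semialgebraic subsets of the
   positive orthant) the Hausdorff dimension is the usual dimension. *)
Definition has_codim (R : realType) (n k : nat) (S : set 'rV[R]_n) : Prop :=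
  S !=set0 -> hausdorff_dim S = (n - k)%:R%:E.

Definition amoeba_intersection (R : realType) (n : nat)
    (F : 'I_n -> laurent R n) : set 'rV[R]_n :=
  \bigcap_(j in [set: 'I_n]) amoeba (F j).

Definition boundary_intersection (R : realType) (n : nat)
    (F : 'I_n -> laurent R n) : set 'rV[R]_n :=
  \bigcap_(j in [set: 'I_n]) boundary (amoeba (F j)).

Definition generic (R : realType) (n : nat) (F : 'I_n -> laurent R n) : Prop :=
  [/\ forall j, laurent_irreducible (F j),
      forall J : {set 'I_n}, (0 < #|J|)%N ->
        has_codim #|J| (\bigcap_(j in [set` J]) boundary (amoeba (F j)))
    & forall (p : 'rV[R]_n) (l : 'I_n),
        amoeba_intersection F p -> boundary (amoeba (F l)) p ->
        exists! E : set 'rV[R]_n,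
          is_component (~` amoeba (F l)) E /\ closure E p].

Definition convex_hull (R : realType) (n : nat) (S : set 'rV[R]_n) :
    set 'rV[R]_n :=
  smallest (fun C : set 'rV[R]_n => @convex_set R 'rV[R]_n C) S.

Definition extreme_points (R : realType) (n : nat) (C : set 'rV[R]_n) :
    set 'rV[R]_n :=
  [set p | C p /\
    forall (x y : 'rV[R]_n) (t : R), C x -> C y -> 0 < t -> t < 1 ->
      p = t *: x + (1 - t) *: y -> x = p /\ y = p].

(* The zero-dimensional faces of P, a face being the part of P on which a
   valid linear inequality <c, x> <= b is tight. *)
Definition vertices (R : realType) (n : nat) (P : set 'rV[R]_n) :
    set 'rV[R]_n :=
  [set v | exists (c : 'rV[R]_n) (b : R),
    (forall x, P x -> \sum_(i < n) c 0 i * x 0 i <= b) /\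
    P `&` [set x | \sum_(i < n) c 0 i * x 0 i = b] = [set v]].

Definition intersection_polytope (R : realType) (n : nat)
    (F : 'I_n -> laurent R n) (K : set 'rV[R]_n) : set 'rV[R]_n :=
  convex_hull (K `&` boundary_intersection F).

(* Main.v *)
(* Let V be the intersection of all the boundaries.  Genericity makes V a set
   of Hausdorff dimension 0; as exp(V) is semialgebraic, its coordinate
   projections are finite (an infinite one would contain an interval), so V is
   finite.  Near a point p of K, condition (3) and the convexity of the
   components of the complement show that each amoeba contains a piece of a
   hyperplane through p, and a full neighbourhood of p when p is not on its
   boundary.  If p is not in V, at most n - 1 hyperplanes occur, so K contains
   a segment centred at p.  Such a point cannot maximise a strictly convex
   function on K, and a small quadratic perturbation of a separating linear
   functional then gives K inside conv(K /\ V).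

   Components of the complement are recovered without integration: the order
   along an integer direction m counts the roots in the unit disk of
   t |-> f(z t^m).  The count is locally constant, and additive in m, because
   averages of the logarithmic derivative over roots of unity approximate it;
   and no root crosses the circle between two points x and x + s m of equal
   order, so the points of given order form a convex set. *)

Require Import Defs.
From HB Require Import structures.
From mathcomp Require Import all_boot all_order all_algebra finmap.
From mathcomp Require Import all_classical all_reals all_analysis.
From mathcomp Require Import complex separable cyclotomic cyclic ring lra zify.
From mathcomp Require ordered_qelim qe_rcf.

Set Implicit Arguments.
Unset Strict Implicit.
Unset Printing Implicit Defensive.

Import Order.TTheory GRing.Theory Num.Theory.
Import numFieldNormedType.Exports.

Local Open Scope classical_set_scope.
Local Open Scope ring_scope.

(** * Counting roots in the unit disk *)

(** The classical routes to the order map and to convex components, through contour integrals and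
    domains of convergence of Laurent series of 1/f, use complex analysis. Here everything is
    reduced to polynomials in one variable: along a one-parameter subgroup, f is a polynomial up to
    a power of t, and its roots locate the amoeba on a line of integer direction. Two obstacles
    shape the argument. Convexity concerns all segments, while only integer directions m carry an
    order, so end points have to be moved until the direction is rational. And a point has
    infinitely many orders, one for each m, while local constancy and finiteness arguments handle
    only finitely many; additivity in m reduces them to the n basis directions. As for V, Hausdorff
    dimension 0 alone does not give finiteness (a countable set has it too), hence the description
    of V by first-order formulas and the use of quantifier elimination. Once conv(K) is known to be
    the hull of a finite set, the claim on vertices becomes the agreement of exposed and extreme
    points of such a hull. *)

Section RootsInDisk.
Variable C : numClosedFieldType.
Implicit Types (P Q : {poly C}) (t r z : C).

Definition poly_roots P : seq C := sval (closed_field_poly_normal P).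

Lemma poly_rootsE P : P = lead_coef P *: \prod_(z <- poly_roots P) ('X - z%:P).
Proof. exact: (svalP (closed_field_poly_normal P)). Qed.

Lemma mem_poly_roots P r : P != 0 -> (r \in poly_roots P) = root P r.
Proof.
by move=> P0; rewrite [P in RHS]poly_rootsE rootZ ?lead_coef_eq0 // root_prod_XsubC.
Qed.

Lemma size_poly_roots P : P != 0 -> size (poly_roots P) = (size P).-1.
Proof.
move=> P0; rewrite [P in RHS]poly_rootsE size_scale ?lead_coef_eq0 //.
by rewrite size_prod_XsubC.
Qed.

(** Since [poly_roots] lists roots with multiplicity, this is the winding number of P along the unit
    circle whenever no root lies on the circle. *)
Definition disk_roots P : nat := count (fun r => `|r| < 1) (poly_roots P).

Lemma disk_roots_le P : P != 0 -> (disk_roots P <= (size P).-1)%N.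
Proof. by move=> P0; rewrite -size_poly_roots // count_size. Qed.

Lemma exists_prim_root k : (0 < k)%N -> exists z : C, k.-primitive_root z.
Proof.
move=> k0; have kN0 : k%:R != 0 :> C by rewrite pnatr_eq0 -lt0n.
have X0 : 'X^k - 1 != 0 :> {poly C} by rewrite -size_poly_eq0 size_XnsubC.
have := @has_prim_root C k (poly_roots ('X^k - 1)) k0.
rewrite size_poly_roots // size_XnsubC // leqnn.
case/(_ _ _ isT)/hasP => [||z _ zk]; last by exists z.
  by apply/allP => z; rewrite mem_poly_roots.
rewrite -separable_prod_XsubC; have := separable_Xn_sub_1 kN0.
by rewrite {1}[_ - 1]poly_rootsE /= lead_coefXnsubC // scale1r.
Qed.

Lemma deriv_prod_XsubC (s : seq C) t : t \notin s ->
  (\prod_(r <- s) ('X - r%:P))^`().[t] =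
  (\prod_(r <- s) ('X - r%:P)).[t] * \sum_(r <- s) (t - r)^-1.
Proof.
elim: s => [|r s IH]; first by rewrite !big_nil derivC hornerC mulr0.
rewrite inE negb_or => /andP[tr ts].
rewrite !big_cons derivM derivXsubC mul1r !hornerE IH //.
by field; rewrite subr_eq0.
Qed.

Lemma log_deriv_sum P t : ~~ root P t ->
  t * P^`().[t] / P.[t] = \sum_(r <- poly_roots P) t / (t - r).
Proof.
move=> Pt; have P0 : P != 0 by apply: contraNneq Pt => ->; rewrite root0.
have ts : t \notin poly_roots P by rewrite mem_poly_roots.
have := Pt; rewrite /root [X in X.[t]]poly_rootsE hornerZ mulf_eq0 negb_or.
case/andP => l0 p0; rewrite {1 2}[P]poly_rootsE derivZ !hornerZ.
rewrite deriv_prod_XsubC // -mulr_sumr.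
move: p0; set a := (\prod_(_ <- _) _).[t] => p0.
by rewrite -poly_rootsE; field; rewrite l0 p0.
Qed.

(** The logarithmic derivative of X^k - 1 = prod (X - z^i) at r gives the sum of the 1 / (r - z^i),
    and z^i / (z^i - r) = 1 - r / (r - z^i). *)
Lemma sum_prim_root k z r : k.-primitive_root z -> r ^+ k != 1 ->
  \sum_(i < k) z ^+ i / (z ^+ i - r) = k%:R / (1 - r ^+ k).
Proof.
move=> zk rk; have k0 := prim_order_gt0 zk.
pose s := [seq z ^+ (i : 'I_k) | i : 'I_k].
have sE : \prod_(y <- s) ('X - y%:P) = 'X^k - 1.
  by rewrite big_image /= -(factor_Xn_sub_1 zk) big_mkord.
have rs : r \notin s.
  by rewrite -root_prod_XsubC sE /root !hornerE subr_eq0.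
have := deriv_prod_XsubC rs; rewrite sE big_image /=.
rewrite derivB derivXn derivC subr0 !hornerE hornerMn !hornerXn => dE.
have rk' : r ^+ k - 1 != 0 by rewrite subr_eq0.
have r1 (i : 'I_k) : z ^+ i - r != 0.
  rewrite subr_eq0; apply: contraNneq rs => <-.
  by apply/mapP; exists i; rewrite ?mem_enum.
transitivity (\sum_(i < k) (1 - r * (r - z ^+ i)^-1)).
  apply: eq_bigr => i _; field; rewrite r1 /=.
  by rewrite -opprB oppr_eq0 r1.
rewrite sumrB -mulr_sumr sumr_const card_ord.
have -> : \sum_(i < k) (r - z ^+ i)^-1 = r ^+ k.-1 *+ k / (r ^+ k - 1).
  by rewrite dE mulrC mulKf.
have rE : r * r ^+ k.-1 = r ^+ k by rewrite -exprS prednK.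
have -> : r * (r ^+ k.-1 *+ k / (r ^+ k - 1)) = k%:R * (r * r ^+ k.-1) / (r ^+ k - 1).
  by rewrite -[_ *+ k]mulr_natl; ring.
rewrite rE; field; by rewrite rk' /= -opprB oppr_eq0 rk'.
Qed.

(** Discrete argument principle: 1 / (1 - r^k) tends to 1 for |r| < 1 and to 0 for |r| > 1 as k
    grows, so the average of t P'/P over the k-th roots of unity tends to the number of roots in the
    disk. *)
Lemma sum_log_deriv_prim_root P k z : k.-primitive_root z ->
  (forall r, root P r -> `|r| != 1) -> P != 0 ->
  \sum_(i < k) z ^+ i * P^`().[z ^+ i] / P.[z ^+ i] =
  k%:R * \sum_(r <- poly_roots P) (1 - r ^+ k)^-1.
Proof.
move=> zk Pr P0; have k0 := prim_order_gt0 zk.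
have z1 : `|z| = 1.
  apply/eqP; rewrite -(@pexpr_eq1 _ _ k) // -normrX (prim_expr_order zk) normr1.
  by [].
under eq_bigr => i _.
  rewrite log_deriv_sum; last first.
    by apply/negP => /Pr; rewrite normrX z1 expr1n eqxx.
  over.
rewrite exchange_big mulr_sumr /= !big_seq; apply: eq_bigr => r.
rewrite mem_poly_roots // => /Pr r1; rewrite sum_prim_root //.
apply: contraNneq r1 => rk.
by rewrite -(@pexpr_eq1 _ _ k) // -normrX rk normr1.
Qed.

Lemma norm_inv1BXn_lt1 (q : C) k r : `|r| <= q -> q ^+ k <= 2^-1 ->
  `|(1 - r ^+ k)^-1 - 1| <= 2 * q ^+ k.
Proof.
move=> rq qk; have q0 : 0 <= q by apply: le_trans rq.
have rk : `|r ^+ k| <= q ^+ k by rewrite normrX lerXn2r // nnegrE.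
have h : 2^-1 <= `|1 - r ^+ k|.
  apply: le_trans (lerB_normD _ _); rewrite normrN normr1 lerBrDr.
  apply: le_trans (lerD (lexx _) (le_trans rk qk)) _.
  by have -> : 2^-1 + 2^-1 = 1 :> C by field.
have n0 : 1 - r ^+ k != 0.
  by rewrite -normr_gt0 (lt_le_trans _ h) // invr_gt0.
have -> : (1 - r ^+ k)^-1 - 1 = r ^+ k / (1 - r ^+ k) by field.
rewrite normrM normfV mulrC ler_pM ?invr_ge0 //.
by rewrite invf_ple ?posrE // ?normr_gt0.
Qed.

Lemma norm_inv1BXn_gt1 (q : C) k r : 0 < q -> q * `|r| >= 1 -> q ^+ k <= 2^-1 ->
  `|(1 - r ^+ k)^-1| <= 2 * q ^+ k.
Proof.
move=> q0 rq qk; have r0 : r != 0.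
  by apply: contraTneq rq => ->; rewrite normr0 mulr0 lt_geF.
have rq' : `|r^-1| <= q.
  by rewrite normfV -div1r ler_pdivrMr ?normr_gt0.
have := norm_inv1BXn_lt1 rq' qk; rewrite exprVn.
suff -> : (1 - (r ^+ k)^-1)^-1 - 1 = - (1 - r ^+ k)^-1 by rewrite normrN.
have rk0 : r ^+ k != 0 by rewrite expf_neq0.
have rk : `|r ^+ k| != 1.
  have : q ^+ k * `|r ^+ k| >= 1 by rewrite normrX -exprMn exprn_ege1.
  apply: contraTneq => ->; rewrite mulr1 lt_geF // (le_lt_trans qk) //.
  by rewrite invf_lt1 // ltr1n.
have : r ^+ k != 1 by apply: contraNneq rk => ->; rewrite normr1.
rewrite -subr_eq0 => rk1; field.
by rewrite rk0 rk1 /= -opprB oppr_eq0 rk1.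
Qed.

(** The annulus q < |r| < 1/q is free of roots. A fixed gap makes the error of the averages
    geometric in k. *)
Definition disk_gap (q : C) P := [/\ 0 < q, q < 1 &
  forall r, root P r -> `|r| <= q \/ q * `|r| >= 1].

Lemma disk_gap_norm q P r : disk_gap q P -> root P r -> `|r| != 1.
Proof.
move=> [q0 q1 /[apply]] -[r1|r1]; first by rewrite lt_eqF // (le_lt_trans r1).
by apply: contraTneq r1 => ->; rewrite mulr1 lt_geF.
Qed.

(** Each root contributes an error of at most 2 q^k: inside the disk 1 / (1 - r^k) is compared with
    1, outside with 0. *)
Lemma disk_roots_avg P q k z : P != 0 -> disk_gap q P -> q ^+ k <= 2^-1 ->
  k.-primitive_root z ->
  `|(\sum_(i < k) z ^+ i * P^`().[z ^+ i] / P.[z ^+ i]) / k%:R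
     - (disk_roots P)%:R| <= (size P)%:R * (2 * q ^+ k).
Proof.
move=> P0 gP qk zk; have k0 := prim_order_gt0 zk.
rewrite (sum_log_deriv_prim_root zk) => [|r /(disk_gap_norm gP)//|//].
rewrite mulrC mulKf ?pnatr_eq0 -?lt0n //.
have [q0 q1 Pr] := gP.
have := size_poly_roots P0; rewrite /disk_roots -sum1_count natr_sum => sE.
rewrite [X in _ - X]big_mkcond -sumrB /=; apply: le_trans (ler_norm_sum _ _ _) _.
apply: (@le_trans _ _ (\sum_(r <- poly_roots P) (2 * q ^+ k))).
  rewrite !big_seq; apply: ler_sum => r; rewrite mem_poly_roots // => /Pr.
  have [r1 [rq|rq]|r1 [rq|rq]] := boolP (`|r| < 1).
  - exact: norm_inv1BXn_lt1.
  - have /lt_geF : q * `|r| < 1 by rewrite mulr_ilt1 // ltW.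
    by rewrite rq.
  - by case/negP: r1; exact: le_lt_trans q1.
  - by rewrite subr0; exact: norm_inv1BXn_gt1.
rewrite big_const_seq count_predT iter_addr_0 sE -[_ *+ _]mulr_natl.
have q0' := ltW q0.
by rewrite ler_wpM2r ?mulr_ge0 ?exprn_ge0 // ler_nat leq_pred.
Qed.

Lemma exists_disk_gap P : P != 0 -> (forall r, root P r -> `|r| != 1) ->
  exists q, disk_gap q P.
Proof.
move=> P0 Pr.
suff [q q0 [q1 qs]] : exists2 q : C, 0 < q & q < 1 /\
    forall r, r \in poly_roots P -> `|r| <= q \/ q * `|r| >= 1.
  by exists q; split=> // r; rewrite -mem_poly_roots //; exact: qs.
have : forall r, r \in poly_roots P -> `|r| != 1.
  by move=> r; rewrite mem_poly_roots //; exact: Pr.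
elim: (poly_roots P) => [_|r s IH rs].
  exists 2^-1; first by rewrite invr_gt0.
  by split=> //; rewrite invf_lt1 // ltr1n.
have [|q q0 [q1 qs]] := IH; first by move=> y ys; apply: rs; rewrite inE ys orbT.
have [q' [q'0 q'1 rq']] : exists q' : C, [/\ 0 < q', q' < 1 & `|r| <= q' \/ q' * `|r| >= 1].
  have := rs r (mem_head _ _); rewrite real_neqr_lt ?realE ?ler01 ?normr_ge0 //.
  case/orP => [r1|r1].
    have [->|r0] := eqVneq r 0.
      exists 2^-1; rewrite invr_gt0 ?invf_lt1 ?ltr1n //; split=> //.
      by left; rewrite normr0 invr_ge0.
    by exists `|r|; rewrite normr_gt0; split=> //; left.
  have r0 : 0 < `|r| by exact: lt_trans r1.
  exists `|r|^-1; rewrite invr_gt0 invf_lt1 //; split=> //.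
  by right; rewrite mulVf // gt_eqF.
(* The order of C is partial, but positive elements are real, so the larger of two gaps can be
   taken. *)
have qr (x y : C) : 0 < x -> 0 < y -> (x <= y) || (y <= x).
  by move=> x0 y0; rewrite real_leVge // gtr0_real.
have qle (x y w : C) : 0 < x -> x <= y -> `|w| <= x \/ x * `|w| >= 1 ->
    `|w| <= y \/ y * `|w| >= 1.
  move=> x0 xy [wx|wx]; first by left; exact: le_trans xy.
  by right; rewrite (le_trans wx) // ler_wpM2r.
have /orP[qq|qq] := qr q q' q0 q'0.
  exists q' => //; split=> // y; rewrite inE => /orP[/eqP -> //|/qs].
  exact: qle.
exists q => //; split=> // y; rewrite inE => /orP[/eqP ->|/qs //].
exact: qle rq'.
Qed.

End RootsInDisk.

(** * Stability of the root count under perturbation *)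

Section RootsInDiskComplex.
Variable R : realType.
Implicit Types (P Q : {poly R[i]}).

Lemma exists_expr_small (q e : R[i]) : 0 < q -> q < 1 -> 0 < e ->
  exists2 k : nat, (0 < k)%N & q ^+ k <= e.
Proof.
move=> q0 q1 e0.
have qE : q = (complex.Re q)%:C%C by rewrite RRe_real ?gtr0_real.
have eE : e = (complex.Re e)%:C%C by rewrite RRe_real ?gtr0_real.
move: q0 q1 e0; rewrite qE eE.
move: (complex.Re q) (complex.Re e) => {qE eE} {}q {}e.
rewrite -[0]/(0%:C)%C -[1]/(1%:C)%C !ltcR => q0 q1 e0.
have := @cvg_expr R q; rewrite ger0_norm 1?ltW // => /(_ q1).
move=> /cvgrPdist_lt /(_ _ e0)[N _ /(_ N.+1 (leqnSn N))] /=.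
rewrite sub0r normrN ger0_norm ?exprn_ge0 1?ltW // => qe.
by exists N.+1 => //; rewrite -rmorphXn lecR ltW.
Qed.

Lemma nat_eq_near (a b : nat) (x : R[i]) :
  `|x - a%:R| <= 2^-1 -> `|x - b%:R| < 2^-1 -> a = b.
Proof.
move=> xa xb; have : `|a%:R - b%:R : R[i]| < 1.
  have -> : a%:R - b%:R = (x - b%:R) - (x - a%:R) :> R[i] by ring.
  apply: le_lt_trans (ler_normB _ _) _.
  have h : 2^-1 + 2^-1 = 1 :> R[i] by field.
  by rewrite -[ltRHS]h addrC ler_ltD.
have [ab|ab|//] := ltngtP a b.
- rewrite distrC -natrB 1?ltnW // normr_nat -[1]/(1%:R) ltr_nat.
  by rewrite ltnS leqn0 subn_eq0 leqNgt ab.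
- rewrite -natrB 1?ltnW // normr_nat -[1]/(1%:R) ltr_nat.
  by rewrite ltnS leqn0 subn_eq0 leqNgt ab.
Qed.

(** A gap of [P * Q] serves both polynomials, so both counts are compared with averages over the
    same roots of unity. Each count is within 1/8 of its average and the averages differ by at most
    1/4, too little to separate two integers. *)
Lemma disk_roots_near_log_deriv P Q :
  (forall t, `|t| = 1 -> ~~ root P t /\ ~~ root Q t) ->
  (forall t, `|t| = 1 ->
    `|P^`().[t] / P.[t] - Q^`().[t] / Q.[t]| <= 4^-1) ->
  disk_roots P = disk_roots Q.
Proof.
move=> PQ dPQ; have [P1 Q1] := PQ 1 (normr1 _).
have P0 : P != 0 by apply: contraNneq P1 => ->; rewrite root0.
have Q0 : Q != 0 by apply: contraNneq Q1 => ->; rewrite root0.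
have [||q gPQ] := @exists_disk_gap _ (P * Q); first by rewrite mulf_neq0.
  move=> r; rewrite rootM => rPQ; apply/eqP => /PQ[rP rQ].
  by move: rPQ; rewrite (negbTE rP) (negbTE rQ).
have [q0 q1 gr] := gPQ.
have gP : disk_gap q P by split=> // r rP; apply: gr; rewrite rootM rP.
have gQ : disk_gap q Q by split=> // r rQ; apply: gr; rewrite rootM rQ orbT.
pose D : R[i] := (size P + size Q).+1%:R.
have D0 : 0 < D by rewrite ltr0n.
(* With q^k below this bound, an error of the form D times 2 q^k is at most 1/8, and q^k is at most
   1/2. *)
have D16 : 0 < (16 * D)^-1 by rewrite invr_gt0 mulr_gt0.
have [k k0 qk] := exists_expr_small q0 q1 D16.
have qk2 : q ^+ k <= 2^-1.
  apply: le_trans qk _; rewrite lef_pV2 ?posrE ?mulr_gt0 //.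
  rewrite -[leLHS]mulr1 ler_pM ?ler_nat // /D.
  by rewrite -[1]/(1%:R) ler_nat.
have [z zk] := exists_prim_root R[i] k0.
have z1 (i : nat) : `|z ^+ i| = 1.
  rewrite normrX; suff -> : `|z| = 1 by rewrite expr1n.
  apply/eqP; rewrite -(@pexpr_eq1 _ _ k) // -normrX (prim_expr_order zk).
  by rewrite normr1.
have small (T : {poly R[i]}) : (size T <= size P + size Q)%N ->
    (size T)%:R * (2 * q ^+ k) <= 8^-1.
  move=> sT; apply: (@le_trans _ _ (D * (2 * (16 * D)^-1))).
    have qk0 : 0 <= q ^+ k by rewrite exprn_ge0 ?ltW.
    by rewrite ler_pM ?mulr_ge0 ?ler_nat ?(leqW sT) // ler_wpM2l.
  by rewrite le_eqVlt; apply/orP; left; apply/eqP; field; rewrite gt_eqF.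
have aP := le_trans (disk_roots_avg P0 gP qk2 zk) (small P (leq_addr _ _)).
have aQ := le_trans (disk_roots_avg Q0 gQ qk2 zk) (small Q (leq_addl _ _)).
set a := (\sum_(i < k) _) / _ in aP; set b := (\sum_(i < k) _) / _ in aQ.
have ab : `|a - b| <= 4^-1.
  rewrite /a /b -mulrBl -sumrB normrM normfV normr_nat ler_pdivrMr ?ltr0n //.
  apply: le_trans (ler_norm_sum _ _ _) _.
  apply: le_trans (_ : \sum_(i < k) 4^-1 <= _); last first.
    by rewrite sumr_const card_ord mulr_natr.
  apply: ler_sum => i _; rewrite -!mulrA -mulrBr normrM z1 mul1r.
  exact/dPQ/z1.
apply: (@nat_eq_near _ _ a).
  by rewrite (le_trans aP) // lef_pV2 ?posrE // ler_nat.
have -> : a - (disk_roots Q)%:R = (a - b) + (b - (disk_roots Q)%:R) by ring.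
apply: le_lt_trans (ler_normD _ _) _.
apply: le_lt_trans (lerD ab aQ) _.
have -> : 4^-1 + 8^-1 = 3 / 8 :> R[i] by field.
by rewrite ltr_pdivrMr // mulrC ltr_pdivlMr // -natrM ltr_nat.
Qed.

Lemma poly_circle_ub P : exists2 M : R[i], 0 <= M &
  forall t, `|t| = 1 -> `|P.[t]| <= M.
Proof.
exists (\sum_(i < size P) `|P`_i|) => [|t t1]; first exact: sumr_ge0.
rewrite horner_coef; apply: le_trans (ler_norm_sum _ _ _) _.
by apply: ler_sum => i _; rewrite normrM normrX t1 expr1n mulr1.
Qed.

(** On the circle |t - r| is at least |1 - |r||, so the factorisation yields an explicit bound,
    without compactness. *)
Lemma poly_circle_lb P : (forall t, `|t| = 1 -> ~~ root P t) ->
  exists2 m : R[i], 0 < m & forall t, `|t| = 1 -> m <= `|P.[t]|.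
Proof.
move=> Pt; have P0 : P != 0.
  by apply: contraNneq (Pt 1 (normr1 _)) => ->; rewrite root0.
exists (`|lead_coef P| * \prod_(r <- poly_roots P) `|1 - `|r| |).
  rewrite mulr_gt0 ?normr_gt0 ?lead_coef_eq0 // big_seq prodr_gt0 // => r.
  rewrite mem_poly_roots // normr_gt0 subr_eq0 => rP.
  by rewrite eq_sym; apply: contraTneq rP => /Pt.
move=> t t1; rewrite [P in leRHS]poly_rootsE hornerZ normrM.
rewrite ler_wpM2l // horner_prod normr_prod ler_prod // => r _.
by rewrite normr_ge0 /= hornerXsubC -{1}t1 ler_dist_dist.
Qed.

(** In the manner of Rouché's theorem: a perturbation that is small compared with the lower bound of
    |P| and the upper bound of |P'| on the circle hardly moves P'/P. *)
Lemma disk_roots_near P : (forall t, `|t| = 1 -> ~~ root P t) ->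
  exists2 e : R[i], 0 < e & forall Q,
    (forall t, `|t| = 1 ->
      `|Q.[t] - P.[t]| <= e /\ `|Q^`().[t] - P^`().[t]| <= e) ->
    (forall t, `|t| = 1 -> ~~ root Q t) /\ disk_roots Q = disk_roots P.
Proof.
move=> Pt; have [m m0 Pm] := poly_circle_lb Pt.
have [M M0 PM] := poly_circle_ub P^`().
(* Once |Q| >= m/2, the logarithmic derivatives differ by at most (M/m + 1) e / (m/2), which is 1/4
   for this e. *)
pose e := m ^+ 2 / (8 * (M + m)).
have Mm0 : 0 < M + m by rewrite ltr_wpDl.
have e0 : 0 < e by rewrite divr_gt0 ?exprn_gt0 ?mulr_gt0.
have em : e <= m / 2.
  rewrite ler_pdivrMr ?mulr_gt0 // expr2 -mulrA ler_pM2l //.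
  have -> : 2^-1 * (8 * (M + m)) = m + (4 * M + 3 * m) by field.
  by rewrite lerDl addr_ge0 ?mulr_ge0 // ltW.
exists e => // Q QP.
have Qm t : `|t| = 1 -> m / 2 <= `|Q.[t]|.
  move=> t1; have [QPt _] := QP t t1.
  have -> : Q.[t] = P.[t] - (P.[t] - Q.[t]) by ring.
  apply: le_trans (lerB_dist _ _); rewrite lerBrDr.
  apply: le_trans (Pm _ t1); rewrite distrC.
  apply: le_trans (lerD (lexx _) (le_trans QPt em)) _.
  by rewrite -splitr.
have Qr t : `|t| = 1 -> ~~ root Q t.
  move=> /Qm Qt; rewrite /root -normr_gt0; apply: lt_le_trans Qt.
  by rewrite divr_gt0.
split=> //; apply/esym/disk_roots_near_log_deriv => t t1.
  by rewrite Pt ?Qr.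
have [QPt dQPt] := QP t t1.
have Pt0 : P.[t] != 0 by exact: Pt.
have Qt0 : Q.[t] != 0 by exact: Qr.
have -> : P^`().[t] / P.[t] - Q^`().[t] / Q.[t] =
    (P^`().[t] / P.[t] * (Q.[t] - P.[t]) - (Q^`().[t] - P^`().[t])) / Q.[t].
  by field; rewrite Pt0 Qt0.
rewrite normrM normfV ler_pdivrMr ?normr_gt0 //.
apply: le_trans (_ : 4^-1 * (m / 2) <= _); last first.
  by rewrite ler_pM2l ?Qm // invr_gt0.
apply: le_trans (ler_normB _ _) _.
apply: le_trans (_ : M / m * e + e <= _).
  apply: lerD => //; rewrite normrM normrM normfV ler_pM ?mulr_ge0 ?invr_ge0 //.
  by rewrite ler_pM ?PM ?invr_ge0 // lef_pV2 ?posrE ?Pm ?normr_gt0.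
have m0' : m != 0 by rewrite gt_eqF.
by rewrite le_eqVlt; apply/orP; left; apply/eqP; rewrite /e; field; rewrite m0' gt_eqF.
Qed.

End RootsInDiskComplex.

(** * Continuity and paths on the unit circle *)

Lemma connected_locally_constant (T : topologicalType) (V : Type) (A : set T)
    (f : T -> V) : connected A ->
  (forall x, A x -> \forall y \near x, A y -> f y = f x) ->
  forall x y, A x -> A y -> f x = f y.
Proof.
move=> cA fA x y Ax Ay.
pose B := [set z | A z /\ f z = f x].
suff BA : B = A by have : B y by [rewrite BA]; case.
pose U v := [set z | A z -> f z = v]°.
have Uv z : A z -> U (f z) z by move/fA.
apply: cA.
- by exists x.
- exists (U (f x)); first exact: open_interior.
  rewrite /B; apply/seteqP; split=> z /= [Az].
    by move=> fz; split=> //; rewrite -fz; exact: Uv.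
  by move=> /interior_subset /(_ Az).
exists (~` [set z | exists2 v, v <> f x & U v z]).
  rewrite closedC openE => z [v vx]; rewrite /U => zv.
  have := open_nbhs_nbhs (conj (@open_interior _ [set z0 | A z0 -> f z0 = v]) zv).
  by apply: filterS => w Uw; exists v.
apply/seteqP; split=> z /= [Az].
  move=> fz; split=> // -[v vx] /interior_subset /(_ Az) fzv.
  by apply: vx; rewrite -fzv.
move=> nz; split=> //; apply: contrapT => fzx; apply: nz.
by exists (f z) => //; exact: Uv.
Qed.

Section Ccont.
Variables (C : numFieldType) (T : topologicalType).
Implicit Types (h g : T -> C) (x : T).

Definition ccont h x : Prop := h @ x --> h x.

Lemma ccont_near h x (e : C) : ccont h x -> 0 < e ->
  \forall y \near x, `|h y - h x| <= e.
Proof.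
move=> hx e0; have /cvgrPdist_le /(_ e e0) := hx.
by apply: filterS => y; rewrite distrC.
Qed.

Lemma ccont_neq0 h x : ccont h x -> h x != 0 -> \forall y \near x, h y != 0.
Proof. by move=> hx h0; exact: cvgr_neq0 hx h0. Qed.

Lemma ccontP h x :
  (forall e : C, 0 < e -> \forall y \near x, `|h y - h x| <= e) -> ccont h x.
Proof.
move=> H; apply/cvgrPdist_le => e /H.
by apply: filterS => y; rewrite distrC.
Qed.

Lemma ccont_cst (c : C) x : ccont (fun=> c) x.
Proof. exact: cvg_cst. Qed.

Lemma ccontD h g x : ccont h x -> ccont g x -> ccont (fun y => h y + g y) x.
Proof. exact: cvgD. Qed.

Lemma ccontM h g x : ccont h x -> ccont g x -> ccont (fun y => h y * g y) x.
Proof. exact: cvgM. Qed.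

Lemma ccontV h x : ccont h x -> h x != 0 -> ccont (fun y => (h y)^-1) x.
Proof. by move=> hx h0; exact: cvgV. Qed.

Lemma ccont_prod (I : Type) (s : seq I) (F : I -> T -> C) x :
  (forall i, ccont (F i) x) -> ccont (fun y => \prod_(i <- s) F i y) x.
Proof.
move=> Fx; elim: s => [|i s IH].
  by under [X in ccont X _]eq_fun do rewrite big_nil; exact: ccont_cst.
under [X in ccont X _]eq_fun do rewrite big_cons.
exact: ccontM.
Qed.

Lemma ccont_sum (I : Type) (s : seq I) (F : I -> T -> C) x :
  (forall i, ccont (F i) x) -> ccont (fun y => \sum_(i <- s) F i y) x.
Proof.
move=> Fx; elim: s => [|i s IH].
  by under [X in ccont X _]eq_fun do rewrite big_nil; exact: ccont_cst.
under [X in ccont X _]eq_fun do rewrite big_cons.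
exact: ccontD.
Qed.

Lemma ccontXn h x (k : nat) : ccont h x -> ccont (fun y => h y ^+ k) x.
Proof.
move=> hx; elim: k => [|k IH].
  by under [X in ccont X _]eq_fun do rewrite expr0; exact: ccont_cst.
under [X in ccont X _]eq_fun do rewrite exprS.
exact: ccontM.
Qed.

Lemma ccontXz h x (k : int) : ccont h x -> h x != 0 ->
  ccont (fun y => h y ^ k) x.
Proof.
move=> hx h0; case: k => k; first exact: ccontXn.
by apply: ccontV; [exact: ccontXn | rewrite expf_neq0].
Qed.

End Ccont.

Section CcontComplex.
Variables (R : realType) (T : topologicalType).
Local Notation C := (R[i] : numFieldType).

Lemma ccont_real (h : T -> R) x : h @ x --> h x ->
  @ccont C T (fun y => (h y)%:C%C) x.
Proof.
move=> hx; apply: ccontP => e e0.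
have eE : e = (complex.Re e)%:C%C by rewrite RRe_real ?gtr0_real.
move: e0; rewrite eE ltcR => e0.
have /cvgrPdist_le /(_ _ e0) := hx; apply: filterS => y.
rewrite distrC -rmorphB /= normc_def /= expr0n addr0 sqrtr_sqr.
by rewrite lecR.
Qed.

Lemma ccont_complex (h g : T -> R) x : h @ x --> h x -> g @ x --> g x ->
  @ccont C T (fun y => (h y +i* g y)%C) x.
Proof.
move=> hx gx.
have -> : (fun y => (h y +i* g y)%C) =
    (fun y => (h y)%:C%C + 'i%C * (g y)%:C%C) :> (T -> C).
  by apply/funext => y; rewrite [LHS]complexE.
apply: (@ccontD C T); first exact: ccont_real.
by apply: (@ccontM C T); [exact: (@ccont_cst C T) | exact: ccont_real].
Qed.

End CcontComplex.

Section UnitPath.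
Variable R : realType.
Local Notation C := (R[i] : numFieldType).

(** A rational parametrisation replaces the argument. Choose y with y^2 = v/u and y != -1; the line
    p(s) = 1 - s + s y avoids 0, and p divided by its conjugate has modulus 1 and runs from 1 to
    y^2. *)
Lemma unit_path (u v : R[i]) : `|u| = 1 -> `|v| = 1 ->
  exists h : R -> R[i], [/\ forall s, @ccont C R h s, forall s, `|h s| = 1,
    h 0 = u & h 1 = v].
Proof.
move=> u1 v1; have u0 : u != 0 by rewrite -normr_gt0 u1.
pose w := v / u; have w1 : `|w| = 1 by rewrite normrM normfV u1 v1 divr1.
have [y [y1 yw yN1]] : exists y : R[i], [/\ `|y| = 1, y ^+ 2 = w & y != -1].
  have [wE|wN] := eqVneq w 1.
    exists 1; rewrite normr1 expr1n wE; split=> //.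
    by rewrite -subr_eq0 opprK -[1 + 1]/(2%:R) pnatr_eq0.
  exists (sqrtC w); rewrite sqrtCK; split=> //.
    by apply/eqP; rewrite -(@pexpr_eq1 _ _ 2) // -normrX sqrtCK w1.
  by apply: contraNneq wN => wE; rewrite -[w]sqrtCK wE sqrrN expr1n.
move: y y1 yw yN1 => [a b] /(congr1 (fun t => complex.Re (t ^+ 2))).
rewrite normc_def -rmorphXn /= sqr_sqrtr ?addr_ge0 ?sqr_ge0 // => ab.
rewrite mulr1 mulr0 subr0 in ab; move=> yw yN1.
pose p (s : R) : R[i] := ((1 - s + s * a) +i* (s * b))%C.
pose p' (s : R) : R[i] := ((1 - s + s * a) -i* (s * b))%C.
have p0 s : (1 - s + s * a) ^+ 2 + (s * b) ^+ 2 != 0.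
  apply: contraNneq yN1; move/eqP; rewrite paddr_eq0 ?sqr_ge0 // !sqrf_eq0.
  case/andP=> /eqP e1; rewrite mulf_eq0 => /orP[/eqP s0|/eqP b0].
    by move/eqP: e1; rewrite s0 subr0 mul0r addr0 oner_eq0.
  have : (a - 1) * (a + 1) = 0 by move: ab; rewrite b0; lra.
  move/eqP; rewrite mulf_eq0 => /orP[|/eqP a1].
    by rewrite subr_eq0 => /eqP a1; move/eqP: e1; rewrite a1 mulr1 subrK oner_eq0.
  rewrite eq_complex /= b0 oppr0 eqxx andbT -subr_eq0 opprK a1.
  by [].
have p'0 s : p' s != 0.
  apply: contraNneq (p0 s) => /eqP; rewrite eq_complex /= oppr_eq0.
  by case/andP=> /eqP -> /eqP ->; rewrite expr0n addr0.
have affc (c : R) (s : R) : (fun s : R => 1 - s + s * c) @ s --> 1 - s + s * c.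
  apply: cvgD; first by apply: cvgB; [exact: cvg_cst | exact: cvg_id].
  by apply: cvgM; [exact: cvg_id | exact: cvg_cst].
have linc (c : R) (s : R) : (fun s : R => s * c) @ s --> s * c.
  by apply: cvgM; [exact: cvg_id | exact: cvg_cst].
exists (fun s => u * (p s / p' s)); split.
- move=> s; apply: (@ccontM C R); first exact: (@ccont_cst C R).
  apply: (@ccontM C R); first by apply: ccont_complex; [exact: affc|exact: linc].
  apply: (@ccontV C R) => //; apply: ccont_complex; first exact: affc.
  by apply: cvgN; exact: linc.
- move=> s; rewrite normrM u1 mul1r normrM normfV.
  have -> : `|p s| = `|p' s| by rewrite !normc_def /= sqrrN.
  by rewrite divff // normr_eq0.
- by rewrite /p /p' subr0 !mul0r !addr0 oppr0 divff ?mulr1 // oner_eq0.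
- rewrite /p /p' subrr !add0r !mul1r.
  have -> : (a +i* b)%C / (a -i* b)%C = w.
    rewrite -yw expr2; congr (_ * _).
    have n0 : (a -i* b)%C != 0.
      by have := p'0 1; rewrite /p' subrr !add0r !mul1r.
    apply: (mulIf n0); rewrite mulVf //.
    apply/eqP; rewrite eq_complex /= mulrN opprK -!expr2 ab eqxx /=.
    by rewrite mulrN [b * a]mulrC addNr.
  by rewrite /w mulrC divfK.
Qed.

End UnitPath.

Lemma near_mem_seq (T : topologicalType) (I : eqType) (y : T) (s : seq I)
    (P : I -> T -> Prop) : (forall a, \forall r \near y, P a r) ->
  \forall r \near y, forall a, a \in s -> P a r.
Proof.
move=> Py; elim: s => [|a s IH]; first exact: nearW.
by apply: filterS2 (Py a) IH => r ar sr b; rewrite inE => /orP[/eqP ->|/sr].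
Qed.

(** * The order map along integer directions *)

Section Monomials.
Variables (C : fieldType) (n : nat).
Implicit Types (z : 'rV[C]_n) (a m : 'rV[int]_n) (t : C).

Definition torus_pt z := forall i, z 0 i != 0.

Definition monomial z a : C := \prod_(i < n) z 0 i ^ a 0 i.

Definition int_dot a m : int := \sum_(i < n) a 0 i * m 0 i.

(** The action on z of the one-parameter subgroup t -> t^m of the torus. *)
Definition twist z m t : 'rV[C]_n := \row_i (z 0 i * t ^ m 0 i).

Lemma int_dotDr a m m' : int_dot a (m + m') = int_dot a m + int_dot a m'.
Proof. by rewrite -big_split; apply: eq_bigr => i _; rewrite mxE mulrDr. Qed.

Lemma monomial_twist z m t a : torus_pt z -> t != 0 ->
  monomial (twist z m t) a = monomial z a * t ^ int_dot a m.
Proof.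
move=> z0 t0; rewrite /int_dot (big_morph _ (fun x y => expfzDr x y t0) (expr0z t)).
rewrite -big_split; apply: eq_bigr => i _ /=.
by rewrite mxE expfzMl exprz_exp [m 0 i * _]mulrC.
Qed.

Lemma twistC z m m' t s : twist (twist z m t) m' s = twist (twist z m' s) m t.
Proof. by apply/rowP => i; rewrite !mxE mulrAC. Qed.

Lemma twistD z m m' t : t != 0 ->
  twist z (m + m') t = twist (twist z m t) m' t.
Proof. by move=> t0; apply/rowP => i; rewrite !mxE expfzDr // mulrA. Qed.

Lemma twistM z m t s : twist z m (t * s) = twist (twist z m t) m s.
Proof. by apply/rowP => i; rewrite !mxE expfzMl mulrA. Qed.

Lemma twist1 z m : twist z m 1 = z.
Proof. by apply/rowP => i; rewrite !mxE exp1rz mulr1. Qed.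

End Monomials.

Section LaurentLine.
Variables (R : realType) (n : nat) (f : laurent R n).
Implicit Types (z : 'rV[R[i]]_n) (a m : 'rV[int]_n) (t : R[i]) (x : 'rV[R]_n).

Lemma laurent_evalE z :
  laurent_eval f z = \sum_(a <- finsupp f) f a * monomial z a.
Proof. by []. Qed.

(** A crude bound for all the exponents |<a, m>| on the support; adding it clears the negative
    powers of t. *)
Definition line_shift m : nat := \sum_(a <- finsupp f) `|int_dot a m|%N.

Definition line_exp m a : nat := `|(int_dot a m + (line_shift m)%:Z)%R|%N.

Lemma line_expE m a : a \in finsupp f ->
  (line_exp m a)%:Z = int_dot a m + (line_shift m)%:Z.
Proof.
move=> af; rewrite /line_exp gez0_abs //.
have : (`|int_dot a m|%N <= line_shift m)%N.
  by rewrite /line_shift (big_fsetD1 a) //= leq_addr.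
by move: (int_dot a m) (line_shift m) => d s; lia.
Qed.

(* t^(line_shift m) f(z t^m), as a polynomial in t *)
Definition line_poly m z : {poly R[i]} :=
  \sum_(a <- finsupp f) (f a * monomial z a) *: 'X^(line_exp m a).

(* The derivative of t |-> f(z t^m) at t = 1. *)
Definition euler m z : R[i] :=
  \sum_(a <- finsupp f) (int_dot a m)%:~R * (f a * monomial z a).

Lemma eulerD m m' z : euler (m + m') z = euler m z + euler m' z.
Proof.
rewrite -big_split; apply: eq_bigr => a _ /=.
by rewrite int_dotDr rmorphD mulrDl.
Qed.

Lemma line_poly_horner m z t : (line_poly m z).[t] =
  \sum_(a <- finsupp f) (f a * monomial z a) * t ^+ line_exp m a.
Proof.
by rewrite horner_sum; apply: eq_bigr => a _; rewrite hornerZ hornerXn.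
Qed.

Lemma line_poly_deriv_horner m z t : (line_poly m z)^`().[t] =
  \sum_(a <- finsupp f) (f a * monomial z a) *
    ((line_exp m a)%:R * t ^+ (line_exp m a).-1).
Proof.
rewrite raddf_sum horner_sum; apply: eq_bigr => a _ /=.
by rewrite derivZ derivXn hornerZ hornerMn hornerXn mulr_natl.
Qed.

(* Otherwise conversion may try to enumerate the roots. *)
#[local] Opaque line_poly disk_roots line_shift.

Lemma line_poly_eval m z t : torus_pt z -> t != 0 ->
  (line_poly m z).[t] = t ^+ line_shift m * laurent_eval f (twist z m t).
Proof.
move=> z0 t0; rewrite laurent_evalE mulr_sumr line_poly_horner !big_seq.
apply: eq_bigr => a af; rewrite monomial_twist //.
rewrite [t ^+ line_exp m a]exprnP line_expE // expfzDr // -exprnP.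
move: (t ^ _) (t ^+ _) (monomial z a) (f a) => *; ring.
Qed.

Lemma line_poly_deriv m z t : torus_pt z -> t != 0 ->
  t * (line_poly m z)^`().[t] = t ^+ line_shift m *
    (euler m (twist z m t) + (line_shift m)%:R * laurent_eval f (twist z m t)).
Proof.
move=> z0 t0; rewrite laurent_evalE [in RHS]mulr_sumr -big_split /=.
rewrite line_poly_deriv_horner !mulr_sumr !big_seq.
apply: eq_bigr => a af.
have -> : t * (f a * monomial z a *
      ((line_exp m a)%:R * t ^+ (line_exp m a).-1))
    = f a * monomial z a * ((line_exp m a)%:R * t ^+ line_exp m a).
  case: (line_exp m a) => [|k]; first by rewrite !mul0r !mulr0.
  rewrite exprS /=.
  by move: (t ^+ k) (f a) (monomial z a) (k.+1%:R) => *; ring.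
rewrite monomial_twist // [t ^+ line_exp m a]exprnP line_expE // expfzDr //.
rewrite -exprnP; have -> : (line_exp m a)%:R =
    (int_dot a m)%:~R + (line_shift m)%:R :> R[i].
  by rewrite -[LHS]/((line_exp m a)%:Z%:~R) line_expE // rmorphD.
move: (t ^ _) (t ^+ _) (monomial z a) (f a) (_%:~R) (_%:R) => *; ring.
Qed.

(** The shift of exponents contributes only a constant. The other term is additive in m through
    [euler], and the additivity of the order rests on this. *)
Lemma line_poly_log_deriv m z t : torus_pt z -> t != 0 ->
  laurent_eval f (twist z m t) != 0 ->
  t * (line_poly m z)^`().[t] / (line_poly m z).[t] =
  euler m (twist z m t) / laurent_eval f (twist z m t) + (line_shift m)%:R.
Proof.
move=> z0 t0 ft; rewrite line_poly_deriv // line_poly_eval //.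
move: (expf_neq0 (line_shift m) t0) ft; move: (t ^+ _) (laurent_eval _ _) => p q p0 q0.
by field; rewrite p0 q0.
Qed.

Lemma line_poly_root m z t : torus_pt z -> t != 0 ->
  root (line_poly m z) t = (laurent_eval f (twist z m t) == 0).
Proof.
move=> z0 t0; rewrite /root line_poly_eval // mulf_eq0.
by rewrite (negbTE (expf_neq0 _ t0)).
Qed.

Lemma norm1_neq0 t : `|t| = 1 -> t != 0.
Proof. by move=> t1; rewrite -normr_gt0 t1. Qed.

Lemma disk_roots_line_near m z0 : torus_pt z0 ->
  (forall t, `|t| = 1 -> laurent_eval f (twist z0 m t) != 0) ->
  exists2 e : R[i], 0 < e & forall z,
    (forall a, a \in finsupp f ->
      `|monomial z a - monomial z0 a| <= e) ->
    disk_roots (line_poly m z) = disk_roots (line_poly m z0).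
Proof.
move=> z00 ft; have [|e e0 He] := @disk_roots_near _ (line_poly m z0).
  by move=> t t1; rewrite line_poly_root ?ft // norm1_neq0.
(* The factor [(line_exp m a).+1] dominates both 1, which is needed for the values on the circle,
   and [line_exp m a], which is needed for the derivatives. *)
pose B : R[i] := \sum_(a <- finsupp f) `|f a| * (line_exp m a).+1%:R.
have B0 : 0 <= B by apply: sumr_ge0 => a _; rewrite mulr_ge0.
have B10 : 0 < B + 1 by rewrite ltr_wpDl.
exists (e / (B + 1)); first by rewrite divr_gt0.
move=> z zz0; have d0 : 0 <= e / (B + 1) by rewrite divr_ge0 ?ltW.
suff H : forall t, `|t| = 1 ->
    `|(line_poly m z).[t] - (line_poly m z0).[t]| <= e /\
    `|(line_poly m z)^`().[t] - (line_poly m z0)^`().[t]| <= e.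
  by have [] := He _ H.
have eB : B * (e / (B + 1)) <= e.
  rewrite mulrCA ler_piMr ?(ltW e0) // ler_pdivrMr // mul1r.
  by rewrite lerDl.
move=> t t1; split; apply: le_trans eB.
  rewrite [X in `|X - _|]line_poly_horner [X in `|_ - X|]line_poly_horner.
  rewrite -sumrB.
  rewrite mulr_suml.
  apply: le_trans (ler_norm_sum _ _ _) _.
  rewrite !big_seq; apply: ler_sum => a af; rewrite -mulrBl -mulrBr.
  rewrite !normrM normrX t1 expr1n mulr1 ler_pM ?zz0 //.
  by rewrite ler_peMr // -[1]/(1%:R) ler_nat.
rewrite [X in `|X - _|]line_poly_deriv_horner.
rewrite [X in `|_ - X|]line_poly_deriv_horner.
rewrite -sumrB.
rewrite mulr_suml.
apply: le_trans (ler_norm_sum _ _ _) _.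
rewrite !big_seq; apply: ler_sum => a af; rewrite -mulrBl -mulrBr.
rewrite !normrM normrX t1 expr1n mulr1 mulrAC normr_nat.
by rewrite ler_pM ?mulr_ge0 ?zz0 // ler_wpM2l // ler_nat.
Qed.

End LaurentLine.

#[local] Opaque line_poly disk_roots line_shift.

(** * Fibres of the logarithmic map, and closedness of the amoeba *)

Section Fibers.
Variables (R : realType) (n : nat).
Implicit Types (z : 'rV[R[i]]_n) (m : 'rV[int]_n) (t : R[i]) (x : 'rV[R]_n).

Lemma normc_real (c : R[i]) : `|c| = (Normc.normc c)%:C%C.
Proof. by case: c => a b; rewrite normc_def. Qed.

Lemma complexr_neq0 (r : R) : (r%:C%C != 0 :> R[i]) = (r != 0).
Proof. by rewrite -[0 in LHS]/(0%:C%C) (inj_eq (@complexI R)). Qed.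

(** With the equation in exponential form, membership in the torus is automatic. *)
Definition fiber x z := forall i, `|z 0 i| = (expR (x 0 i))%:C%C.

Definition fiber_base x : 'rV[R[i]]_n := \row_i (expR (x 0 i))%:C%C.

Lemma fiber_baseP x : fiber x (fiber_base x).
Proof.
by move=> i; rewrite mxE ger0_norm // -[0]/(0%:C%C) lecR expR_ge0.
Qed.

Lemma fiber_torus x z : fiber x z -> torus_pt z.
Proof. by move=> xz i; rewrite -normr_gt0 xz -[0]/(0%:C%C) ltcR expR_gt0. Qed.

Lemma amoebaP (f : laurent R n) x :
  amoeba f x <-> exists2 z, fiber x z & laurent_eval f z = 0.
Proof.
split=> [[z [z0 fz] <-]|[z xz fz]].
  exists z => // i; rewrite mxE lnK ?normc_real // posrE.
  by have := z0 i; rewrite -normr_gt0 normc_real -[0]/(0%:C%C) ltcR.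
exists z; first by split=> //; exact: fiber_torus xz.
apply/rowP => i; rewrite mxE.
by have := xz i; rewrite normc_real => -[->]; rewrite expRK.
Qed.

Lemma fiber_twist x z m t (s : R) : fiber x z -> `|t| = (expR s)%:C%C ->
  fiber (x + s *: map_mx intr m) (twist z m t).
Proof.
move=> xz ts i; rewrite !mxE normrM xz expRD rmorphM /=; congr (_ * _).
have norm_Xz (k : int) : `|t ^ k| = `|t| ^ k.
  by case: k => k; rewrite ?NegzE /= ?normfV normrX.
rewrite norm_Xz ts; case: (m 0 i) => k.
  by rewrite -exprnP -rmorphXn /= -expRM_natl mulrC.
rewrite NegzE -exprnN -rmorphXn /= -expRM_natl -fmorphV /= -expRN.
by rewrite mulrNz mulrN mulrC.
Qed.

Lemma fiber_twist1 x z m t : fiber x z -> `|t| = 1 -> fiber x (twist z m t).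
Proof.
move=> xz t1; have := @fiber_twist x z m t 0 xz.
by rewrite expR0 scale0r addr0; apply.
Qed.

Variable f : laurent R n.
Implicit Type a : 'rV[int]_n.

Lemma ccont_monomial (T : topologicalType) (g : T -> 'rV[R[i]]_n) a y :
  (forall i, @ccont (R[i] : numFieldType) T (fun s => g s 0 i) y) ->
  torus_pt (g y) -> @ccont (R[i] : numFieldType) T (fun s => monomial (g s) a) y.
Proof.
move=> gy g0; apply: (@ccont_prod (R[i] : numFieldType) T) => i.
exact: (@ccontXz (R[i] : numFieldType) T).
Qed.

(** The parameter space is arbitrary because the lemma is applied both to a path inside one fibre
    and to a base point moving in R^n. *)
Lemma disk_roots_line_locally_constant (T : topologicalType)
    (g : T -> 'rV[R[i]]_n) m y :
  (forall i, @ccont (R[i] : numFieldType) T (fun s => g s 0 i) y) ->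
  torus_pt (g y) ->
  (forall t, `|t| = 1 -> laurent_eval f (twist (g y) m t) != 0) ->
  \forall s \near y,
    disk_roots (line_poly f m (g s)) = disk_roots (line_poly f m (g y)).
Proof.
move=> gy g0 fg; have [e e0 He] := disk_roots_line_near g0 fg.
suff : \forall s \near y, forall a, a \in finsupp f ->
    `|monomial (g s) a - monomial (g y) a| <= e.
  by apply: filterS => s; exact: He.
apply: near_mem_seq => a.
exact: (@ccont_near (R[i] : numFieldType) T _ _ _
  (ccont_monomial (a := a) gy g0) e0).
Qed.

Lemma fiber_eval_neq0 x z m t : ~ amoeba f x -> fiber x z -> `|t| = 1 ->
  laurent_eval f (twist z m t) != 0.
Proof.
move=> fx xz t1; apply/eqP => ft; apply/fx/amoebaP.
by exists (twist z m t) => //; exact: fiber_twist1.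
Qed.

(** The fibre is a product of circles, hence path connected, and f has no zero on it, so the count
    is constant along a path from z to z'. *)
Lemma disk_roots_fiber x z z' m : ~ amoeba f x -> fiber x z -> fiber x z' ->
  disk_roots (line_poly f m z) = disk_roots (line_poly f m z').
Proof.
move=> fx xz xz'.
have e0 i : (expR (x 0 i))%:C%C != 0 :> R[i] by rewrite complexr_neq0 gt_eqF ?expR_gt0.
pose u (y : 'rV[R[i]]_n) i := y 0 i / (expR (x 0 i))%:C%C.
have u1 y i : fiber x y -> `|u y i| = 1.
  move=> xy; rewrite normrM normfV xy ger0_norm ?divff //.
  by rewrite -[0]/(0%:C%C) lecR expR_ge0.
have /choice[h hP] : forall i, exists h : R -> R[i],
    [/\ forall s, @ccont (R[i] : numFieldType) R h s, forall s, `|h s| = 1,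
        h 0 = u z i & h 1 = u z' i].
  by move=> i; apply: unit_path; exact: u1.
pose g (s : R) : 'rV[R[i]]_n := \row_i ((expR (x 0 i))%:C%C * h i s).
have xg s : fiber x (g s).
  move=> i; have [_ h1 _ _] := hP i; rewrite mxE normrM h1 mulr1 ger0_norm //.
  by rewrite -[0]/(0%:C%C) lecR expR_ge0.
have -> : z = g 0.
  by apply/rowP => i; have [_ _ h0 _] := hP i; rewrite mxE h0 mulrC divfK.
have -> : z' = g 1.
  by apply/rowP => i; have [_ _ _ h1] := hP i; rewrite mxE h1 mulrC divfK.
apply: (@connected_locally_constant _ _ setT
  (fun s => disk_roots (line_poly f m (g s)))) => // [|s _].
  by apply/connected_intervalP.
have : \forall s' \near s,
    disk_roots (line_poly f m (g s')) = disk_roots (line_poly f m (g s)).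
  apply: disk_roots_line_locally_constant.
  - move=> i; have [hc _ _ _] := hP i.
    have -> : (fun s => g s 0 i) = (fun s => (expR (x 0 i))%:C%C * h i s).
      by apply/funext => r; rewrite mxE.
    apply: (@ccontM (R[i] : numFieldType) R) => //.
    exact: (@ccont_cst (R[i] : numFieldType) R).
  - exact: fiber_torus (xg s).
  - by move=> t t1; exact: fiber_eval_neq0 fx (xg s) t1.
by apply: filterS.
Qed.

(* The pairing of m with the order of x: by the argument principle, the
   winding number of t |-> f(z t^m) on the unit circle, for any z above x. *)
Definition order_map m x : int :=
  (disk_roots (line_poly f m (fiber_base x)))%:Z - (line_shift f m)%:Z.

Lemma order_fiber m x z : ~ amoeba f x -> fiber x z ->
  order_map m x = (disk_roots (line_poly f m z))%:Z - (line_shift f m)%:Z.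
Proof.
move=> fx xz.
exact: (congr1 (fun k : nat => k%:Z - (line_shift f m)%:Z)
  (disk_roots_fiber m fx (fiber_baseP x) xz)).
Qed.

Lemma cvg_coord (T : topologicalType) (g : T -> 'rV[R]_n) i y :
  g @ y --> g y -> (fun s => g s 0 i) @ y --> g y 0 i.
Proof.
move=> gy; apply: (@continuous_comp _ _ _ g (fun M : 'rV[R]_n => M 0 i)) => //.
exact: coord_continuous.
Qed.

Lemma ccont_expR (T : topologicalType) (g : T -> 'rV[R]_n) i y :
  g @ y --> g y -> @ccont (R[i] : numFieldType) T
    (fun s => (expR (g s 0 i))%:C%C) y.
Proof.
move=> gy; apply: ccont_real.
apply: (@continuous_comp _ _ _ (fun s => g s 0 i) (@expR R)).
  exact: cvg_coord.
exact: continuous_expR.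
Qed.

Lemma order_locally_constant m x : ~ amoeba f x ->
  \forall y \near x, order_map m y = order_map m x.
Proof.
move=> fx; have : \forall y \near x,
    disk_roots (line_poly f m (fiber_base y)) =
    disk_roots (line_poly f m (fiber_base x)).
  apply: disk_roots_line_locally_constant.
  - move=> i; have -> : (fun s => fiber_base s 0 i) =
        (fun s : 'rV[R]_n => (expR (s 0 i))%:C%C).
      by apply/funext => r; rewrite mxE.
    exact: ccont_expR.
  - exact: fiber_torus (fiber_baseP x).
  - by move=> t t1; exact: fiber_eval_neq0 fx (fiber_baseP x) t1.
apply: filterS => y e.
exact: (congr1 (fun k : nat => k%:Z - (line_shift f m)%:Z) e).
Qed.

(** A tube lemma: f has no zero on the compact fibre over x, hence none on the fibres nearby. The
    compact set is a box of real and imaginary parts; the circle equations enter as a hypothesis of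
    [P], which holds vacuously near points of the box that violate them. *)
Lemma open_amoebaC : open (~` amoeba f).
Proof.
rewrite openE => x fx.
pose box : set 'rV[R]_n := [set v | forall i, `[-1, 1]%classic (v 0 i)].
have cbox : compact box.
  by apply: (@rV_compact R n (fun=> `[-1, 1]%classic)) => i; exact: segment_compact.
have /compact_near_coveringP ncK := compact_setX cbox cbox.
pose pt (y : 'rV[R]_n) (p : 'rV[R]_n * 'rV[R]_n) : 'rV[R[i]]_n :=
  \row_i ((expR (y 0 i))%:C%C * (p.1 0 i +i* p.2 0 i)%C).
pose P (y : 'rV[R]_n) (p : 'rV[R]_n * 'rV[R]_n) :=
  (forall i, p.1 0 i ^+ 2 + p.2 0 i ^+ 2 = 1) ->
  laurent_eval f (pt y p) != 0.
have eval_cont (p : 'rV[R]_n * 'rV[R]_n) : torus_pt (pt x p) ->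
    @ccont (R[i] : numFieldType) (('rV[R]_n * 'rV[R]_n) * 'rV[R]_n)%type
      (fun q => laurent_eval f (pt q.2 q.1)) (p, x).
  move=> p0; apply: (@ccont_sum (R[i] : numFieldType)) => a.
  apply: (@ccontM (R[i] : numFieldType)).
    exact: (@ccont_cst (R[i] : numFieldType)).
  apply: ccont_monomial => // i.
  have -> : (fun q : ('rV[R]_n * 'rV[R]_n) * 'rV[R]_n => pt q.2 q.1 0 i) =
      (fun q => (expR (q.2 0 i))%:C%C * (q.1.1 0 i +i* q.1.2 0 i)%C).
    by apply/funext => q; rewrite mxE.
  apply: (@ccontM (R[i] : numFieldType)).
    by apply: ccont_expR; exact: cvg_snd.
  apply: ccont_complex; apply: cvg_coord.
    exact: (cvg_comp _ _ cvg_fst cvg_fst).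
  exact: (cvg_comp _ _ cvg_fst cvg_snd).
have near_box p : (box `*` box) p ->
    \forall p' \near p & y \near nbhs x, P y p'.
  move=> _; have [p1|] := pselect (forall i, p.1 0 i ^+ 2 + p.2 0 i ^+ 2 = 1).
    have xp : fiber x (pt x p).
      move=> i; rewrite mxE normrM ger0_norm; last first.
        by rewrite -[0]/(0%:C%C) lecR expR_ge0.
      by rewrite normc_def /= p1 sqrtr1 mulr1.
    have fp : laurent_eval f (pt x p) != 0.
      by apply/eqP => fp; apply/fx/amoebaP; exists (pt x p).
    have := ccont_neq0 (eval_cont p (fiber_torus xp)) fp.
    by apply: filterS => q fq _.
  move=> /existsNP[i pi].
  pose d (q : ('rV[R]_n * 'rV[R]_n) * 'rV[R]_n) : R[i] :=
    (q.1.1 0 i ^+ 2 + q.1.2 0 i ^+ 2 - 1)%:C%C.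
  have : \forall q \near (p, x), d q != 0.
    apply: (@ccont_neq0 (R[i] : numFieldType)).
      apply: ccont_real; apply: cvgB; last exact: cvg_cst.
      have c1 : (fun q : ('rV[R]_n * 'rV[R]_n) * 'rV[R]_n => q.1.1 0 i) @ (p, x)
          --> p.1 0 i.
        by apply: (@cvg_coord _ (fun q => q.1.1)); exact: (cvg_comp _ _ cvg_fst cvg_fst).
      have c2 : (fun q : ('rV[R]_n * 'rV[R]_n) * 'rV[R]_n => q.1.2 0 i) @ (p, x)
          --> p.2 0 i.
        by apply: (@cvg_coord _ (fun q => q.1.2)); exact: (cvg_comp _ _ cvg_fst cvg_snd).
      exact: (cvgD (cvgM c1 c1) (cvgM c2 c2)).
    by apply/eqP => -[/eqP]; rewrite subr_eq0 => /eqP.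
  apply: filterS => q q1 /(_ i) q2; move: q1.
  by rewrite /d /= q2 subrr eqxx.
have nK : \forall y \near x, (box `*` box) `<=` P y by exact: ncK near_box.
apply: filterS nK => y Py.
move=> /amoebaP[z yz fz].
have e0 i : (expR (y 0 i))%:C%C != 0 :> R[i] by rewrite complexr_neq0 gt_eqF ?expR_gt0.
pose w i := z 0 i / (expR (y 0 i))%:C%C.
have w1 i : complex.Re (w i) ^+ 2 + complex.Im (w i) ^+ 2 = 1.
  apply: (@complexI R); rewrite add_Re2_Im2 /w normrM normfV yz.
  by rewrite ger0_norm ?divff ?expr1n // -[0]/(0%:C%C) lecR expR_ge0.
pose p := (\row_i complex.Re (w i), \row_i complex.Im (w i)) : 'rV[R]_n * 'rV[R]_n.
have bd (a b : R) : a ^+ 2 + b ^+ 2 = 1 -> `[-1, 1]%classic a.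
  move=> ab; rewrite /= in_itv /= -ler_norml -(@ler_pXn2r _ 2) ?nnegrE //.
  by rewrite expr1n real_normK ?num_real // -ab lerDl sqr_ge0.
have : laurent_eval f (pt y p) != 0.
  apply: Py.
    split=> i /=; rewrite mxE; first exact: bd (w1 i).
    by apply: (bd _ (complex.Re (w i))); rewrite addrC w1.
  by move=> i; rewrite !mxE w1.
suff -> : pt y p = z by rewrite fz eqxx.
apply/rowP => i; rewrite !mxE /=.
have -> : (complex.Re (w i) +i* complex.Im (w i))%C = w i by case: (w i).
by rewrite mulrC divfK.
Qed.

End Fibers.

(** * Finite-dimensional convex geometry *)

Lemma cvg_subr (R : realType) (V : normedModType R) (p y : V) :
  (fun z => z - p) @ y --> y - p.
Proof. by apply: cvgB; [exact: cvg_id|exact: cvg_cst]. Qed.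

Section ConvexGeometry.
Variables (R : realType) (n : nat).
Implicit Types (x y c p : 'rV[R]_n) (S C K : set 'rV[R]_n) (t b : R).

Definition vdot c x : R := \sum_(i < n) c 0 i * x 0 i.

Lemma vdotDr c x y : vdot c (x + y) = vdot c x + vdot c y.
Proof. by rewrite -big_split; apply: eq_bigr => i _; rewrite mxE mulrDr. Qed.

Lemma vdotZr c t x : vdot c (t *: x) = t * vdot c x.
Proof. by rewrite mulr_sumr; apply: eq_bigr => i _; rewrite mxE mulrCA. Qed.

Lemma vdotC c x : vdot c x = vdot x c.
Proof. by apply: eq_bigr => i _; rewrite mulrC. Qed.

Lemma vdotNr c x : vdot c (- x) = - vdot c x.
Proof. by rewrite -scaleN1r vdotZr mulN1r. Qed.

Lemma vdotBr c x y : vdot c (x - y) = vdot c x - vdot c y.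
Proof. by rewrite vdotDr vdotNr. Qed.

Lemma vdotDl c p x : vdot (c + p) x = vdot c x + vdot p x.
Proof. by rewrite vdotC vdotDr !(vdotC x). Qed.

Lemma vdotZl c t x : vdot (t *: c) x = t * vdot c x.
Proof. by rewrite vdotC vdotZr vdotC. Qed.

Lemma vdot_sqrD x y t : vdot (x + t *: y) (x + t *: y) =
  vdot x x + t * (2 * vdot x y + t * vdot y y).
Proof.
rewrite vdotDl (vdotDr x) (vdotDr (t *: y)) !vdotZl !vdotZr (vdotC y x).
by ring.
Qed.

Lemma vdotNl c x : vdot (- c) x = - vdot c x.
Proof. by rewrite vdotC vdotNr vdotC. Qed.

Lemma vdot_ge0 x : 0 <= vdot x x.
Proof. by apply: sumr_ge0 => i _; rewrite -expr2 sqr_ge0. Qed.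

Lemma vdot_eq0 x : (vdot x x == 0) = (x == 0).
Proof.
apply/eqP/eqP => [x0|->]; last by rewrite /vdot big1 // => i _; rewrite mxE mul0r.
apply/rowP => i; rewrite mxE; apply/eqP; rewrite -sqrf_eq0 expr2.
move/eqP: x0; rewrite psumr_eq0 => [/allP/(_ i)|j _]; last first.
  by rewrite -expr2 sqr_ge0.
by rewrite mem_index_enum => /(_ isT).
Qed.

Lemma vdot_gt0 x : x != 0 -> 0 < vdot x x.
Proof. by move=> x0; rewrite lt_def vdot_ge0 vdot_eq0 x0. Qed.

Lemma cvg_vdot (T : topologicalType) (F : set_system T) (g h : T -> 'rV[R]_n) c x :
  Filter F -> g @ F --> c -> h @ F --> x ->
  (fun s => vdot (g s) (h s)) @ F --> vdot c x.
Proof.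
move=> FF gc hx; rewrite /vdot; apply: cvg_big => [|i _].
  exact: add_continuous.
apply: cvgM.
  exact: (cvg_comp _ (fun M : 'rV[R]_n => M 0 i) gc (@coord_continuous _ _ _ 0 i c)).
exact: (cvg_comp _ (fun M : 'rV[R]_n => M 0 i) hx (@coord_continuous _ _ _ 0 i x)).
Qed.

Lemma cvg_vdotl (T : topologicalType) (F : set_system T) (g : T -> 'rV[R]_n) c x :
  Filter F -> g @ F --> c -> (fun s => vdot (g s) x) @ F --> vdot c x.
Proof. by move=> FF gc; apply: cvg_vdot gc _; exact: cvg_cst. Qed.

Lemma continuous_vdotl x : continuous (fun c => vdot c x).
Proof.
by move=> c; exact: (@cvg_vdotl _ (nbhs c) id c x (@nbhs_filter _ c)).
Qed.

Lemma convex_setP C : @convex_set R 'rV[R]_n C <->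
  forall x y t, 0 <= t -> t <= 1 -> C x -> C y -> C (t *: x + (1 - t) *: y).
Proof.
split=> [cC x y t t0 t1 Cx Cy|H x y l].
  have t01 : Itv.spec (@Itv.num_sem R) (Itv.Real `[0%Z, 1%Z]) t.
    by rewrite /= /Itv.num_sem /= in_itv /= t0 t1 num_real.
  have := cC x y (Itv.mk t01); rewrite !inE /= => /(_ Cx Cy).
  by [].
by rewrite !inE => Cx Cy; apply: H.
Qed.

Lemma sub_convex_hull S : S `<=` convex_hull S.
Proof. by move=> x Sx C [_]; apply. Qed.

Lemma convex_hull_min S C : @convex_set R 'rV[R]_n C -> S `<=` C ->
  convex_hull S `<=` C.
Proof. by move=> cC SC x; apply; split. Qed.

Lemma convex_hull_convex S : @convex_set R 'rV[R]_n (convex_hull S).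
Proof.
apply/convex_setP => x y t t0 t1 Sx Sy C [cC SC].
by move/convex_setP: (cC); apply=> //; [exact: Sx | exact: Sy].
Qed.

Lemma convex_hull_comb S x y t : 0 <= t -> t <= 1 -> convex_hull S x ->
  convex_hull S y -> convex_hull S (t *: x + (1 - t) *: y).
Proof.
move=> t0 t1 Sx Sy.
by have /convex_setP := @convex_hull_convex S; exact.
Qed.

Lemma convex_setU1 C p : @convex_set R 'rV[R]_n C ->
  (forall x t, 0 < t -> t <= 1 -> C x -> C (t *: x + (1 - t) *: p)) ->
  @convex_set R 'rV[R]_n (C `|` [set p]).
Proof.
move=> /convex_setP cC Cp; apply/convex_setP => x y t t0 t1 [Cx|->] [Cy|->].
- by left; exact: cC.
- move: t0; rewrite le_eqVlt => /orP[/eqP <-|t0]; last by left; exact: Cp.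
  by right; rewrite scale0r add0r subr0 scale1r.
- have [->|tN1] := eqVneq t 1; first by right; rewrite subrr scale0r addr0 scale1r.
  left; rewrite addrC -{2}[t](subKr 1); apply: Cp => //.
    by rewrite subr_gt0 lt_neqAle tN1.
  by rewrite lerBlDr lerDl.
- by right; rewrite /= -scalerDl addrC subrK scale1r.
Qed.

(** In a combination of two points of the cone with apex v, the weights of v add up to T, and the
    other two terms, renormalised by 1 - T, give a point of the hull of s. For empty s the
    right-hand side would be empty. *)
Lemma convex_hull_cons v (s : seq 'rV[R]_n) :
  (0 < size s)%N ->
  convex_hull [set` v :: s] =
  (fun q : R * 'rV[R]_n => q.1 *: v + (1 - q.1) *: q.2) @`
    (`[0, 1] `*` convex_hull [set` s]).
Proof.
case: s => [//|w s] _; set s' := w :: s; apply/seteqP; split; last first.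
  move=> _ [[t y] [/= tI sy] <-]; move: tI; rewrite in_itv /= => /andP[t0 t1].
  apply: convex_hull_comb => //.
    by apply: sub_convex_hull; rewrite /= mem_head.
  apply: (convex_hull_min (@convex_hull_convex _) _ sy) => z /= zs.
  by apply: sub_convex_hull; rewrite /= inE zs orbT.
apply: convex_hull_min; last first.
  move=> z /=; rewrite inE => /orP[/eqP ->|zs].
    exists (1, w) => /=; last by rewrite subrr scale0r addr0 scale1r.
    by split=> /=; [rewrite in_itv /= ler01 lexx|apply: sub_convex_hull; exact: mem_head].
  exists (0, z) => /=; last by rewrite subr0 scale0r add0r scale1r.
  by split=> /=; [rewrite in_itv /= ler01 lexx|exact: sub_convex_hull].
apply/convex_setP => _ _ t t0 t1 [[a x] [/= aI sx] <-] [[b y] [/= bI sy] <-].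
move: aI bI; rewrite !in_itv /= => /andP[a0 a1] /andP[b0 b1].
have t1' : 0 <= 1 - t by rewrite subr_ge0.
have a1' : 0 <= 1 - a by rewrite subr_ge0.
have b1' : 0 <= 1 - b by rewrite subr_ge0.
pose T := t * a + (1 - t) * b.
have T0 : 0 <= T by rewrite addr_ge0 ?mulr_ge0.
have TE : 1 - T = t * (1 - a) + (1 - t) * (1 - b) by rewrite /T; ring.
have T1' : 0 <= 1 - T by rewrite TE addr_ge0 ?mulr_ge0.
(* No renormalisation is possible here, but both terms off the apex have weight 0. *)
have [T1|TN1] := eqVneq (1 - T) 0.
  have e1 : t * (1 - a) = 0.
    by have := mulr_ge0 t0 a1'; have := mulr_ge0 t1' b1'; rewrite TE in T1; lra.
  have e2 : (1 - t) * (1 - b) = 0 by rewrite TE in T1; lra.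
  exists (T, x); first by split=> //=; rewrite in_itv /= T0; rewrite -subr_ge0.
  rewrite /= T1 scale0r addr0 !scalerDr !scalerA e1 e2 !scale0r !addr0.
  by rewrite -scalerDl.
pose l := t * (1 - a) / (1 - T).
have lE : 1 - l = (1 - t) * (1 - b) / (1 - T).
  by rewrite /l TE; field; rewrite -TE.
exists (T, l *: x + (1 - l) *: y).
  split=> /=; first by rewrite in_itv /= T0 -subr_ge0.
  apply: convex_hull_comb => //.
    by rewrite divr_ge0 ?mulr_ge0.
  by rewrite -subr_ge0 lE divr_ge0 ?mulr_ge0.
rewrite /= lE scalerDr !scalerA /l !(mulrCA (1 - T)) divff // !mulr1.
rewrite !scalerDr !scalerA scalerDl addrACA; congr (_ + _).
Qed.

Lemma compact_convex_hull (s : seq 'rV[R]_n) : compact (convex_hull [set` s]).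
Proof.
elim: s => [|v [|w s] IH].
- suff -> : convex_hull [set` [::]] = set0 :> set 'rV[R]_n by exact: compact0.
  apply/seteqP; split=> // x; apply: (@convex_hull_min _ set0) => [|y //].
  by apply/convex_setP => a b t _ _ [].
- suff -> : convex_hull [set` [:: v]] = [set v] by exact: compact_set1.
  apply/seteqP; split=> [|x ->]; last by apply: sub_convex_hull; exact: mem_head.
  apply: convex_hull_min => [|x /=]; last by rewrite inE => /eqP.
  apply/convex_setP => x y t _ _ /= -> ->.
  by rewrite -scalerDl addrC subrK scale1r.
rewrite convex_hull_cons //; apply: continuous_compact.
  apply: continuous_subspaceT => q; apply: cvgD.
    by apply: cvgZr_tmp; exact: cvg_fst.
  apply: cvgZ; last exact: cvg_snd.
  by apply: cvgB; [exact: cvg_cst|exact: cvg_fst].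
by apply: compact_setX => //; exact: segment_compact.
Qed.

(** Take c = q - p with q the point of the hull nearest to p: if <c, v - q> were negative, moving
    from q towards v would come closer to p. *)
Lemma finite_separation (s : seq 'rV[R]_n) p :
  ~ convex_hull [set` s] p ->
  exists c, forall v, v \in s -> vdot c p < vdot c v.
Proof.
move=> sp; case: s sp => [|w s] sp; first by exists 0.
set H := convex_hull _ in sp.
have cH : compact H by exact: compact_convex_hull.
pose g y := vdot (y - p) (y - p).
have cg : continuous g.
  move=> y; have h := @cvg_subr R _ p y.
  exact: (@cvg_vdot _ (nbhs y) (fun z => z - p) (fun z => z - p) _ _
    (@nbhs_filter _ y) h h).
have [||q] := @EVT_min_rV R n g H _ cH.
- by exists w; apply: sub_convex_hull; exact: mem_head.
- exact: continuous_subspaceT.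
rewrite inE => Hq qmin; exists (q - p) => v vs.
have Hv : H v by exact: sub_convex_hull.
have qp : 0 < vdot (q - p) (q - p).
  by apply: vdot_gt0; rewrite subr_eq0; apply: contra_notN sp => /eqP <-.
rewrite -subr_gt0 -vdotBr.
have -> : v - p = (v - q) + (q - p) by rewrite addrA subrK.
rewrite vdotDr ltr_wpDl // leNgt; apply/negP => d0.
set d := vdot (q - p) (v - q) in d0; set e := vdot (v - q) (v - q).
have e0 : 0 <= e by exact: vdot_ge0.
(* The squared distance changes by t (2 d + t e), and this t gives 2 d + t e = (1 + t) d < 0; t <= 1
   because e >= 0. *)
pose t := - d / (e - d).
have ed : 0 < e - d by lra.
have t0 : 0 < t by rewrite divr_gt0 // oppr_gt0.
have t1 : t <= 1 by rewrite ler_pdivrMr // mul1r; lra.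
have Hy : H (t *: v + (1 - t) *: q).
  apply: convex_hull_comb => //.
  exact: ltW.
have := qmin (t *: v + (1 - t) *: q); rewrite inE => /(_ Hy).
rewrite /g; have -> : t *: v + (1 - t) *: q - p = (q - p) + t *: (v - q).
  by rewrite scalerBl scale1r scalerBr; apply/rowP => i; rewrite !mxE; ring.
rewrite vdot_sqrD -/d -/e.
apply/negP; rewrite -ltNge.
have : t * (e - d) = - d by rewrite /t divfK // gt_eqF.
move=> td; rewrite gtrDl pmulr_rlt0 //.
have : t * d <= 0 by rewrite mulr_ge0_le0 // ltW.
by lra.
Qed.

(** C need not be closed. Every finite part of C is separated from p by a vector of the unit sphere,
    and compactness of the sphere provides one vector for all of C, at the price of a weak
    inequality. *)
Lemma convex_separation C p : @convex_set R 'rV[R]_n C -> C !=set0 -> ~ C p ->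
  exists2 c, c != 0 & forall y, C y -> 0 <= vdot c (y - p).
Proof.
move=> cC [w Cw] Cp.
pose Sph : set 'rV[R]_n := [set c | `|c| = 1].
have cS : compact Sph.
  apply: bounded_closed_compact.
    by exists 1; split=> // M M1 x /= ->; exact: ltW.
  have -> : Sph = (fun c : 'rV[R]_n => `|c|) @^-1` [set 1 : R] by [].
  apply: closed_comp; last exact: closed_eq.
  by move=> x _; exact: norm_continuous.
have := cS; rewrite compact_In0 => /(_ 'rV[R]_n C
  (fun y => Sph `&` [set c | 0 <= vdot c (y - p)])).
case=> [|D DC|c cP].
- exists (fun y => [set c | 0 <= vdot c (y - p)]) => // y _.
  have -> : [set c | 0 <= vdot c (y - p)] =
      (fun c => vdot c (y - p)) @^-1` [set r | 0 <= r] by [].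
  apply: closed_comp; last exact: closed_ge.
  by move=> c _; exact: continuous_vdotl.
- have sD : ~ convex_hull [set` (w :: (D : seq _))] p.
    move=> h; apply: Cp; apply: (convex_hull_min cC _ h) => y /=.
    rewrite inE => /orP[/eqP -> //|yD].
    by have := DC y yD; rewrite inE.
  have [c cs] := finite_separation sD.
  have c0 : c != 0.
    apply/eqP => c0; have := cs w (mem_head _ _).
    by rewrite c0 -(scale0r 0) !vdotZl !mul0r ltxx.
  exists (`|c|^-1 *: c) => y /= yD; split.
    by rewrite /Sph /= normrZ normfV normr_id mulVf // normr_eq0.
  rewrite /= vdotZl mulr_ge0 ?invr_ge0 // vdotBr subr_ge0 ltW //.
  by apply: cs; rewrite inE yD orbT.
have c1 := (cP w Cw).1.
exists c; last by move=> y Cy; exact: (cP y Cy).2.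
by rewrite -normr_gt0 c1.
Qed.

(** An open set on one side of a hyperplane cannot touch it: from a point of contact, a small step
    along -c would leave the half-space. *)
Lemma open_convex_supporting C p : @convex_set R 'rV[R]_n C -> open C ->
  C !=set0 -> ~ C p ->
  exists2 c, c != 0 & forall y, vdot c (y - p) = 0 -> ~ C y.
Proof.
move=> cC oC C0 Cp; have [c c0 cP] := convex_separation cC C0 Cp.
exists c => // y cy Cy; move: oC; rewrite openE => /(_ y Cy) nC.
have := @cvgB; have : (fun t : R => y - t *: c) @ 0 --> y - 0 *: c.
  apply: cvgB; first exact: cvg_cst.
  by apply: cvgZr_tmp; exact: cvg_id.
rewrite scale0r subr0 => /(_ _ nC) /nbhs_ballP[e /= e0 He] _.
have /cP : C (y - (e / 2) *: c).
  apply: He; rewrite /ball /= sub0r normrN gtr0_norm ?divr_gt0 //.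
  by rewrite ltr_pdivrMr // ltr_pMr // ltr1n.
have -> : y - (e / 2) *: c - p = (y - p) - (e / 2) *: c.
  by apply/rowP => i; rewrite !mxE; ring.
rewrite vdotBr cy sub0r vdotZr; apply/negP; rewrite -ltNge oppr_lt0.
by rewrite mulr_gt0 ?divr_gt0 // vdot_gt0.
Qed.

(* A vertex is separated from the remaining points because deleting an
   extreme point leaves a convex set. *)
Lemma vertices_convex_hull_finite (s : seq 'rV[R]_n) :
  vertices (convex_hull [set` s]) = extreme_points (convex_hull [set` s]).
Proof.
set P := convex_hull _; apply/seteqP; split=> p.
  move=> [c [b [Pb Pe]]].
  have [Pp cp] : (P `&` [set x | vdot c x = b]) p by rewrite [X in X p]Pe.
  split=> // x y t Px Py t0 t1 pE.
  have bx : vdot c x <= b by exact: Pb.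
  have by_ : vdot c y <= b by exact: Pb.
  have : t * vdot c x + (1 - t) * vdot c y = b.
    by rewrite -cp pE vdotDr !vdotZr.
  have t1' : 0 < 1 - t by rewrite subr_gt0.
  move=> e.
  have ex : vdot c x = b.
    apply/eqP; rewrite eq_le bx leNgt; apply/negP => xb.
    have := ltr_pM2l t0 (vdot c x) b; rewrite xb => tx.
    by have := ler_wpM2l (ltW t1') by_; move: tx => /idP; lra.
  have ey : vdot c y = b.
    apply/eqP; rewrite eq_le by_ leNgt; apply/negP => yb.
    have := ltr_pM2l t1' (vdot c y) b; rewrite yb => ty.
    by have := ler_wpM2l (ltW t0) bx; move: ty => /idP; lra.
  have xin : (P `&` [set x | vdot c x = b]) x by [].
  have yin : (P `&` [set x | vdot c x = b]) y by [].
  by move: xin yin; rewrite [X in X x]Pe [X in X y]Pe => -> ->.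
move=> [Pp pext].
have cPp : @convex_set R 'rV[R]_n (P `\ p).
  apply/convex_setP => x y t t0 t1 [Px /= xp] [Py /= yp]; split.
    exact: convex_hull_comb.
  move=> /esym pE; have [t00|t00] := eqVneq t 0.
    by apply: yp; rewrite pE t00 scale0r add0r subr0 scale1r.
  have [t11|t11] := eqVneq t 1.
    by apply: xp; rewrite pE t11 subrr scale0r addr0 scale1r.
  have [||xp' _] := pext x y t Px Py _ _ pE; last exact: xp.
    by rewrite lt_def t00.
  by rewrite lt_def eq_sym t11.
have sp : ~ convex_hull [set` [seq v <- s | v != p]] p.
  move=> h; suff : (P `\ p) p by move=> [_ /(_ erefl)].
  apply: (convex_hull_min cPp _ h) => v /=.
  rewrite mem_filter => /andP[/eqP vp vs]; split=> //.
  exact: sub_convex_hull.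
have [c cs] := finite_separation sp.
(* An open half-space with one boundary point adjoined is still convex. It contains P, so -c attains
   its maximum on P at p alone. *)
have cC : @convex_set R 'rV[R]_n ([set x | vdot c p < vdot c x] `|` [set p]).
  apply: convex_setU1 => [|x t t0 t1 /= cx].
    apply/convex_setP => x y t t0 t1 /= cx cy; rewrite vdotDr !vdotZr.
    have [->|tN0] := eqVneq t 0; first by rewrite mul0r add0r subr0 mul1r.
    have t00 : 0 < t by rewrite lt_def tN0.
    have := ltr_pM2l t00 (vdot c p) (vdot c x); rewrite cx => /idP tx.
    by have t1' : 0 <= 1 - t; [rewrite subr_ge0|have := ler_wpM2l t1' (ltW cy); lra].
  rewrite vdotDr !vdotZr.
  by have := ltr_pM2l t0 (vdot c p) (vdot c x); rewrite cx => /idP; lra.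
have PC : P `<=` [set x | vdot c p < vdot c x] `|` [set p].
  apply: convex_hull_min => // v vs; have [->|vp] := eqVneq v p; first by right.
  by left; apply: cs; rewrite mem_filter vp.
exists (- c), (- vdot c p); rewrite -/(vdot _ _).
split=> [x /PC[/= cx|->]|]; rewrite -/(vdot (- c) _) ?vdotNl ?lerN2 // ?ltW //.
apply/seteqP; split=> [x [Px /=]|x ->]; last by split=> //=; exact: vdotNl.
rewrite -/(vdot (- c) x) vdotNl => /oppr_inj cx.
by case: (PC x Px) => //=; rewrite cx ltxx.
Qed.

End ConvexGeometry.

(** * Components of the complement of an amoeba *)

#[local] Transparent line_poly.

Lemma complexr_lt1 (R : rcfType) (r : R) : (r%:C%C < 1 :> R[i]) = (r < 1).
Proof. exact: (ltcR r 1). Qed.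

Lemma complexr_ge1 (R : rcfType) (r : R) : (1 <= r%:C%C :> R[i]) = (1 <= r).
Proof. exact: (lecR 1 r). Qed.

Lemma expR_ge1 (R : realType) (r : R) : (1 <= expR r) = (0 <= r).
Proof. by rewrite leNgt expR_lt1 -leNgt. Qed.

Lemma norm_expR (R : realType) (r : R) : `|(expR r)%:C%C : R[i]| = (expR r)%:C%C.
Proof. by rewrite ger0_norm // ler0c expR_ge0. Qed.

Lemma prod_XsubC_perm (F : fieldType) (s1 s2 : seq F) :
  \prod_(r <- s1) ('X - r%:P) = \prod_(r <- s2) ('X - r%:P) -> perm_eq s1 s2.
Proof.
elim: s1 s2 => [|a s1 IH] s2 e.
  have /eqP := size_prod_XsubC s2 id; rewrite -e big_nil size_poly1 eqSS eq_sym.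
  by rewrite size_eq0 => /eqP ->.
have as2 : a \in s2 by rewrite -root_prod_XsubC -e root_prod_XsubC mem_head.
rewrite perm_sym; apply: perm_trans (perm_to_rem as2) _.
rewrite perm_cons perm_sym; apply: IH.
have aX : 'X - a%:P != 0 :> {poly F} by rewrite polyXsubC_eq0.
apply: (mulfI aX); move: e; rewrite big_cons => ->.
by rewrite (perm_big _ (perm_to_rem as2)) big_cons.
Qed.

(** The substitution divides every root by l. It relates the counts over x and over x + s m, a disk
    of radius 1 over the latter being one of radius e^s over the former. *)
Lemma disk_roots_scale (C : numClosedFieldType) (P : {poly C}) (c l : C) :
  P != 0 -> c != 0 -> 0 < l ->
  disk_roots (c *: (P \Po (l *: 'X))) =
  count (fun r => `|r| < l) (poly_roots P).
Proof.
move=> P0 c0 l0; set Q := c *: _.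
have l0' : l != 0 by rewrite gt_eqF.
pose s := [seq r / l | r <- poly_roots P].
pose d := c * lead_coef P * l ^+ size (poly_roots P).
have QE : Q = d *: \prod_(r <- s) ('X - r%:P).
  rewrite /Q [P in P \Po _]poly_rootsE comp_polyZ scalerA /d -[RHS]scalerA.
  congr (_ *: _); rewrite /s; elim: (poly_roots P) => [|r t IH].
    by rewrite !big_nil comp_polyC expr0 scale1r.
  rewrite !big_cons comp_polyM IH comp_polyB comp_polyX comp_polyC.
  rewrite /= exprS -!mul_polyC polyCM !mulrA; congr (_ * _); rewrite mulrAC.
  congr (_ * _); rewrite mulrBr -[X in _ = _ - X]polyCM mulrC.
  by rewrite [l * _]mulrC divfK // mulrC.
have d0 : d != 0 by rewrite !mulf_neq0 ?lead_coef_eq0 ?expf_neq0.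
have lQ : lead_coef Q = d.
  rewrite QE lead_coefZ (monicP _) ?mulr1 // monic_prod_XsubC //.
have pe : perm_eq (poly_roots Q) s.
  apply: prod_XsubC_perm; apply: (scalerI d0).
  by rewrite -QE -{1}lQ -poly_rootsE.
transitivity (count (fun r => `|r| < 1) s); first by exact: (permP pe).
rewrite count_map; apply: eq_count => r /=.
by rewrite normrM normfV (gtr0_norm l0) ltr_pdivrMr // mul1r.
Qed.

(** Multiplication by z permutes the k-th roots of unity. *)
Lemma sum_prim_shift (C : idomainType) (V : nmodType) k (z : C) (i : nat)
    (F : C -> V) : k.-primitive_root z ->
  \sum_(j < k) F (z ^+ i * z ^+ j) = \sum_(j < k) F (z ^+ j).
Proof.
case: k => [/prim_order_gt0//|k] zk; elim: i F => [|i IH] F.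
  by apply: eq_bigr => j _; rewrite mul1r.
under eq_bigr => j _ do rewrite exprS -mulrA.
rewrite (IH (fun y => F (z * y))) big_ord_recr [RHS]big_ord_recl /= addrC.
congr (_ + _); first by rewrite -exprS (prim_expr_order zk).
by apply: eq_bigr => j _; rewrite -exprS.
Qed.

Lemma avg_near (C : numFieldType) k (a : 'I_k -> C) (c e : C) : (0 < k)%N ->
  (forall j, `|a j - c| <= e) -> `|(\sum_(j < k) a j) / k%:R - c| <= e.
Proof.
move=> k0 ae; have k0' : k%:R != 0 :> C by rewrite pnatr_eq0 -lt0n.
have -> : (\sum_(j < k) a j) / k%:R - c = (\sum_(j < k) (a j - c)) / k%:R.
  rewrite sumrB sumr_const card_ord mulrBl -[c *+ k]mulr_natr mulfK //.
rewrite normrM normfV normr_nat ler_pdivrMr ?ltr0n //.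
apply: le_trans (ler_norm_sum _ _ _) _.
apply: le_trans (ler_sum _ (fun j _ => ae j)) _.
by rewrite sumr_const card_ord mulr_natr.
Qed.

Lemma avg_near2 (C : numFieldType) k (a : 'I_k -> 'I_k -> C) (c e : C) :
  (0 < k)%N -> (forall i, `|(\sum_(j < k) a i j) / k%:R - c| <= e) ->
  `|(\sum_(i < k) \sum_(j < k) a i j) / k%:R / k%:R - c| <= e.
Proof. by move=> k0 ae; rewrite [X in X / _]mulr_suml; exact: avg_near. Qed.

Lemma sum_ord_exchange (V : nmodType) k (a : 'I_k -> 'I_k -> V) :
  \sum_i \sum_j a i j = \sum_j \sum_i a i j.
Proof. exact: exchange_big. Qed.

Lemma posz_subI (a b c : nat) : a%:Z - c%:Z = b%:Z - c%:Z -> a = b.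
Proof. by move=> /addIr[]. Qed.

Lemma int_near_eq (C : numDomainType) (a b : int) :
  `|(a - b)%:~R : C| < 1 -> a = b.
Proof. by rewrite -intr_norm (ltr_int C _ 1) => h; lia. Qed.

Lemma eq_count_sub (T : eqType) (p q : pred T) (s : seq T) x :
  subpred p q -> count p s = count q s -> x \in s -> q x -> p x.
Proof.
move=> pq; elim: s => [//|a s IH] /= + + qx; have := sub_count pq s.
rewrite inE => le e /orP[/eqP xa|xs]; last first.
  apply: (IH _ xs qx); move: e; case: (boolP (p a)) => [/pq -> /addnI //|_].
  by case: (q a) => // e; move: le; rewrite -[count p s]add0n e add1n ltnn.
subst a; move: e; rewrite qx; case: (p x) => // e.
by move: le; rewrite -[count p s]add0n e add1n ltnn.
Qed.

Lemma additive_row_int n (phi : 'rV[int]_n -> int) :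
  {morph phi : a b / a + b} ->
  forall m, phi m = \sum_(i < n) m 0 i * phi (delta_mx 0 i).
Proof.
move=> phiD m; have phi0 : phi 0 = 0.
  by apply: (addrI (phi 0)); rewrite -phiD !addr0.
have phiN a : phi (- a) = - phi a.
  by apply: (addrI (phi a)); rewrite -phiD !subrr.
have phin a k : phi (a *+ k) = phi a *+ k.
  by elim: k => [|k IH]; rewrite ?mulr0n // !mulrS phiD IH.
rewrite {1}[m]row_sum_delta (big_morph phi phiD phi0).
apply: eq_bigr => i _; case: (m 0 i) => k.
  by rewrite -natz scaler_nat phin mulr_natl.
by rewrite NegzE -natz scaleNr scaler_nat phiN phin mulNr mulr_natl.
Qed.

(** * Additivity of the order, and segments of equal order *)

Section Order.
Variables (R : realType) (n : nat) (f : laurent R n).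
Implicit Types (z : 'rV[R[i]]_n) (m : 'rV[int]_n) (t : R[i]) (x y : 'rV[R]_n).
Local Notation dir m := (map_mx (intr : int -> R) m).

Lemma line_poly_twist m z t : torus_pt z -> t != 0 ->
  line_poly f m (twist z m t) =
  (t ^+ line_shift f m)^-1 *: (line_poly f m z \Po (t *: 'X)).
Proof.
move=> z0 t0; rewrite /line_poly raddf_sum scaler_sumr !big_seq.
apply: eq_bigr => a af /=; rewrite comp_polyZ comp_Xn_poly exprZn !scalerA.
congr (_ *: _); rewrite monomial_twist // [t ^+ line_exp f m a]exprnP.
rewrite line_expE // expfzDr // -exprnP.
have := expf_neq0 (line_shift f m) t0.
move: (t ^ _) (t ^+ _) (monomial z a) (f a) => u v w c v0.
by field.
Qed.

(** The bound does not involve z: the error estimates become uniform over a fibre, and only finitely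
    many orders occur for each m. *)
Lemma size_line_poly m z :
  (size (line_poly f m z) <= (\sum_(a <- finsupp f) line_exp f m a).+1)%N.
Proof.
rewrite /line_poly; elim: (finsupp f : seq _) => [|a s IH].
  by rewrite !big_nil size_poly0.
rewrite !big_cons; apply: leq_trans (size_polyD _ _) _.
rewrite geq_max; apply/andP; split.
  apply: leq_trans (size_scale_leq _ _) _.
  by rewrite size_polyXn ltnS leq_addr.
by apply: leq_trans IH _; rewrite ltnS leq_addl.
Qed.

#[local] Opaque line_poly.

Lemma line_poly_circle x z m t : ~ amoeba f x -> fiber x z -> `|t| = 1 ->
  ~~ root (line_poly f m z) t.
Proof.
move=> fx xz t1; rewrite line_poly_root ?(norm1_neq0 t1) //.
  exact: fiber_eval_neq0 fx xz t1.
exact: fiber_torus xz.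
Qed.

Lemma line_poly_neq0 x z m : ~ amoeba f x -> fiber x z -> line_poly f m z != 0.
Proof.
move=> fx xz; apply: contraNneq (line_poly_circle m fx xz (normr1 _)) => ->.
exact: root0.
Qed.

Lemma cvg_line x v : (fun s : R => x + s *: v) @ 0 --> x.
Proof.
have -> : x = x + 0 *: v by rewrite scale0r addr0.
apply: cvgD; first by rewrite scale0r addr0; exact: cvg_cst.
by apply: cvgZr_tmp; exact: cvg_id.
Qed.

Lemma fiber_root_amoeba x z m t : fiber x z -> t != 0 ->
  root (line_poly f m z) t -> amoeba f (x + ln (Normc.normc t) *: dir m).
Proof.
move=> xz t0; rewrite line_poly_root //; last exact: fiber_torus xz.
move=> /eqP ft; apply/amoebaP; exists (twist z m t) => //.
apply: fiber_twist => //; rewrite normc_real lnK // posrE.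
by have := t0; rewrite -normr_gt0 normc_real -[0]/(0%:C%C) ltcR.
Qed.

(** A root of modulus e^s puts x + s m into the amoeba, and the complement of the amoeba contains a
    ball around x; so |s| is bounded below, uniformly in the fibre and in the listed m. *)
Lemma order_gap x (ms : seq 'rV[int]_n) : ~ amoeba f x ->
  exists q, forall m z, m \in ms -> fiber x z -> disk_gap q (line_poly f m z).
Proof.
move=> fx.
have : \forall s \near (0 : R), forall m, m \in ms ->
    ~ amoeba f (x + s *: dir m).
  apply: near_mem_seq => m.
  have := @open_amoebaC R n f; rewrite openE => /(_ x fx) nx.
  exact: (@cvg_line x (dir m) _ nx).
move=> /nbhs_ballP[d /= d0 dP].
have d20 : 0 < d / 2 by rewrite divr_gt0.
exists (expR (- (d / 2)))%:C%C => m z mms xz; split.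
- by rewrite -[0]/(0%:C%C) ltcR expR_gt0.
- by rewrite complexr_lt1 expR_lt1 oppr_lt0.
move=> r rP; have [->|r0] := eqVneq r 0.
  by left; rewrite normr0 -[0]/(0%:C%C) lecR expR_ge0.
have := fiber_root_amoeba xz r0 rP; set s := ln _ => As.
have rE : `|r| = (expR s)%:C%C.
  rewrite normc_real lnK // posrE.
  by have := r0; rewrite -normr_gt0 normc_real -[0]/(0%:C%C) ltcR.
have sd : ~ (`|s| < d).
  by move=> sd; apply: (dP s _ m mms As); rewrite /ball /= sub0r normrN.
rewrite rE lecR -rmorphM /= -expRD complexr_ge1 ler_expR expR_ge1.
have [s0|s0] := leP s (- (d / 2)); [by left|right].
rewrite addrC subr_ge0 leNgt; apply/negP => s1; apply: sd.
by rewrite ltr_norml; lra.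
Qed.

Lemma order_avg x m q k (w : R[i]) z D : ~ amoeba f x -> fiber x z ->
  disk_gap q (line_poly f m z) -> q ^+ k <= 2^-1 -> k.-primitive_root w ->
  (size (line_poly f m z) <= D)%N ->
  `|(\sum_(i < k) euler f m (twist z m (w ^+ i)) /
      laurent_eval f (twist z m (w ^+ i))) / k%:R - (order_map f m x)%:~R|
    <= D%:R * (2 * q ^+ k).
Proof.
move=> fx xz gq qk wk sD; have k0 := prim_order_gt0 wk.
have z0 := fiber_torus xz.
have w1 (i : nat) : `|w ^+ i| = 1.
  rewrite normrX; suff -> : `|w| = 1 by rewrite expr1n.
  apply/eqP; rewrite -(@pexpr_eq1 _ _ k) // -normrX (prim_expr_order wk).
  by rewrite normr1.
have := disk_roots_avg (line_poly_neq0 m fx xz) gq qk wk.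
have -> : \sum_(i < k) w ^+ i * (line_poly f m z)^`().[w ^+ i] /
      (line_poly f m z).[w ^+ i] =
    \sum_(i < k) (euler f m (twist z m (w ^+ i)) /
      laurent_eval f (twist z m (w ^+ i)) + (line_shift f m)%:R).
  apply: eq_bigr => i _; apply: line_poly_log_deriv => //.
    exact: norm1_neq0.
  exact: fiber_eval_neq0 fx xz (w1 i).
have -> : (order_map f m x)%:~R =
    (disk_roots (line_poly f m z))%:R - (line_shift f m)%:R :> R[i].
  by rewrite (order_fiber m fx xz) rmorphB.
rewrite big_split /= sumr_const card_ord -[_ *+ k]mulr_natr mulrDl.
rewrite mulfK ?pnatr_eq0 -?lt0n //.
move: (\sum_(i < k) _) (disk_roots _) (line_shift _ _) => A N S.
rewrite opprB addrA [A / _ + _ + _]addrC addrC; move=> h.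
apply: le_trans (_ : (size (line_poly f m z))%:R * (2 * q ^+ k) <= _).
  by move: h; congr (`|_| <= _); ring.
have [q0 _ _] := gq.
by rewrite ler_wpM2r ?ler_nat // mulr_ge0 // exprn_ge0 // ltW.
Qed.

(** Average [euler] / f over the points z w^(i m) w^(j m') for all pairs i, j. Summing over i first
    approximates the order along m, over j first the order along m', and replacing j by i + j makes
    i run along m + m'. As [euler] is additive in the direction, the integers in question differ by
    at most 3/8. *)
Lemma order_additive x m m' : ~ amoeba f x ->
  order_map f (m + m') x = order_map f m x + order_map f m' x.
Proof.
move=> fx; have [q gq] := order_gap [:: m; m'; m + m'] fx.
have gm z := gq m z (mem_head _ _).
have gm' z : fiber x z -> disk_gap q (line_poly f m' z).
  by apply: gq; rewrite !inE eqxx orbT.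
have gmm z : fiber x z -> disk_gap q (line_poly f (m + m') z).
  by apply: gq; rewrite !inE eqxx !orbT.
pose S m1 := (\sum_(a <- finsupp f) line_exp f m1 a).+1.
pose D := (S m + S m' + S (m + m')%R)%N.
have D0 : 0 < (16 * D%:R)^-1 :> R[i].
  by rewrite invr_gt0 mulr_gt0 // ltr0n /D addSn.
have bx := fiber_baseP x.
have [q0 q1 _] := gm _ bx.
have [k k0 qk] := exists_expr_small q0 q1 D0.
have D1 : 1 <= D%:R :> R[i] by rewrite -[1]/(1%:R) ler_nat /D addSn.
have qk2 : q ^+ k <= 2^-1.
  apply: le_trans qk _; have D00 : 0 < D%:R :> R[i] by exact: lt_le_trans D1.
  rewrite lef_pV2 ?posrE ?mulr_gt0 //.
  by rewrite -[leLHS]mulr1 ler_pM ?ler_nat.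
have De : D%:R * (2 * q ^+ k) <= 8^-1.
  apply: (@le_trans _ _ (D%:R * (2 * (16 * D%:R)^-1))).
    by rewrite ler_wpM2l // ler_wpM2l.
  rewrite le_eqVlt; apply/orP; left; apply/eqP; field.
  by rewrite gt_eqF // (lt_le_trans _ D1).
have [w wk] := exists_prim_root R[i] k0.
have w1 (i : nat) : `|w ^+ i| = 1.
  rewrite normrX; suff -> : `|w| = 1 by rewrite expr1n.
  apply/eqP; rewrite -(@pexpr_eq1 _ _ k) // -normrX (prim_expr_order wk).
  by rewrite normr1.
pose z := fiber_base x.
pose p (i j : 'I_k) := twist (twist z m (w ^+ i)) m' (w ^+ j).
pose g m1 (y : 'rV[R[i]]_n) := euler f m1 y / laurent_eval f y.
pose B m1 := \sum_i \sum_j g m1 (p i j).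
pose A m1 := B m1 / k%:R / k%:R.
have k0' : k%:R != 0 :> R[i] by rewrite pnatr_eq0 -lt0n.
have Am' : `|A m' - (order_map f m' x)%:~R| <= 8^-1.
  apply: avg_near2 => // i; apply: le_trans De.
  have xi : fiber x (twist z m (w ^+ i)) by exact: fiber_twist1 bx (w1 i).
  apply: order_avg => //; first exact: gm'.
  by apply: leq_trans (size_line_poly _ _) _; rewrite /D addnAC leq_addl.
have AE m1 : A m1 = (\sum_j \sum_i g m1 (p i j)) / k%:R / k%:R.
  exact: (congr1 (fun u => u / k%:R / k%:R)
    (sum_ord_exchange (fun i j => g m1 (p i j)))).
have Am : `|A m - (order_map f m x)%:~R| <= 8^-1.
  rewrite AE; apply: avg_near2 => // j; apply: le_trans De.
  have xj : fiber x (twist z m' (w ^+ j)) by exact: fiber_twist1 bx (w1 j).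
  under eq_bigr => i _ do rewrite /p twistC.
  apply: order_avg => //; first exact: gm.
  by apply: leq_trans (size_line_poly _ _) _; rewrite /D -addnA leq_addr.
have Amm : `|A (m + m') - (order_map f (m + m') x)%:~R| <= 8^-1.
  have Bmm : A (m + m') = (\sum_(j < k) \sum_(i < k) g (m + m')
      (twist (twist z m' (w ^+ j)) (m + m') (w ^+ i))) / k%:R / k%:R.
    apply: (congr1 (fun u => u / k%:R / k%:R)); apply: (etrans _ (sum_ord_exchange
      (fun i j : 'I_k => g (m + m') (twist (twist z m' (w ^+ j)) (m + m') (w ^+ i))))).
    apply: eq_bigr => i _.
    pose G (y : R[i]) := g (m + m') (twist (twist z m (w ^+ i)) m' y).
    (* The inner sum is reindexed by j -> i + j, so that w^i acts through m + m'. *)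
    transitivity (\sum_(j < k) G (w ^+ i * w ^+ j)).
      exact: (esym (sum_prim_shift i G wk)).
    apply: eq_bigr => j _.
    have tE : twist (twist z m (w ^+ i)) m' (w ^+ i * w ^+ j) =
        twist (twist z m' (w ^+ j)) (m + m') (w ^+ i).
      by rewrite twistM -(twistD _ _ _ (norm1_neq0 (w1 i))) twistC.
    exact: (congr1 (g (m + m')) tE).
  have Hmm (j : 'I_k) : `|(\sum_(i < k) g (m + m')
      (twist (twist z m' (w ^+ j)) (m + m') (w ^+ i))) / k%:R
      - (order_map f (m + m') x)%:~R| <= 8^-1.
    have xj : fiber x (twist z m' (w ^+ j)) by exact: fiber_twist1 bx (w1 j).
    have sD : (size (line_poly f (m + m') (twist z m' (w ^+ j))) <= D)%N.
      by apply: leq_trans (size_line_poly _ _) _; rewrite /D leq_addl.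
    exact: (le_trans (order_avg fx xj (gmm _ xj) qk2 wk sD) De).
  exact: (eq_ind_r (fun u => `|u - _| <= 8^-1) (avg_near2 k0 Hmm) Bmm).
have AD : A (m + m') = A m + A m'.
  rewrite /A -!mulrDl; apply: (congr1 (fun u => u / k%:R / k%:R)).
  rewrite /B -big_split; apply: eq_bigr => i _ /=.
  rewrite -big_split; apply: eq_bigr => j _ /=.
  by rewrite /g eulerD mulrDl.
move: Am Am' Amm; rewrite AD.
move: (order_map f m x) (order_map f m' x) (order_map f (m + m') x) (A m) (A m').
move=> a b c u v ua vb uvc.
apply: (@int_near_eq R[i]).
have -> : (c - (a + b))%:~R =
    ((u - a%:~R) + (v - b%:~R)) - (u + v - c%:~R) :> R[i].
  by rewrite !(rmorphB, rmorphD) /=; ring.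
apply: le_lt_trans (ler_normB _ _) _.
apply: le_lt_trans (lerD (le_trans (ler_normD _ _) (lerD ua vb)) uvc) _.
have -> : 8^-1 + 8^-1 + 8^-1 = 3 / 8 :> R[i] by field.
by rewrite ltr_pdivrMr // mul1r ltr_nat.
Qed.

Lemma order_same x y : ~ amoeba f x -> ~ amoeba f y ->
  (forall i, order_map f (delta_mx 0 i) x = order_map f (delta_mx 0 i) y) ->
  forall m, order_map f m x = order_map f m y.
Proof.
move=> fx fy xy m.
rewrite (additive_row_int (fun a b => order_additive a b fx) m).
rewrite (additive_row_int (fun a b => order_additive a b fy) m).
by apply: eq_bigr => i _; rewrite xy.
Qed.

Lemma order_map_finite m : exists D : nat, forall x, ~ amoeba f x ->
  exists2 d : nat, (d < D)%N & order_map f m x = d%:Z - (line_shift f m)%:Z.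
Proof.
exists ((\sum_(a <- finsupp f) line_exp f m a).+2)%N => x fx.
exists (disk_roots (line_poly f m (fiber_base x))); last by [].
have l0 := line_poly_neq0 m fx (fiber_baseP x).
rewrite ltnS; apply: leq_trans (disk_roots_le l0) _.
apply: leq_trans (leq_pred _) _; exact: (size_line_poly m (fiber_base x)).
Qed.

(** Up to the same shift, the orders at x and x + s m count the roots of one polynomial in the open
    disks of radius 1 and e^s; if they agree, no root has modulus in [1, e^s[. A zero of f over x +
    r m with r < s, twisted back to the fibre over x, would give the root e^r there. *)
Lemma order_segment x m (s r : R) : ~ amoeba f x ->
  ~ amoeba f (x + s *: dir m) -> order_map f m x = order_map f m (x + s *: dir m) ->
  0 <= r <= s -> ~ amoeba f (x + r *: dir m).
Proof.
move=> fx fy xy /andP[r0 rs] /amoebaP[z' wz' fz'].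
pose e (u : R) : R[i] := (expR u)%:C%C.
have e0 u : e u != 0 by rewrite complexr_neq0 gt_eqF ?expR_gt0.
have ne u : `|e u| = (expR u)%:C%C by exact: norm_expR.
pose z := twist z' m (e (- r)).
have xz : fiber x z.
  by have := fiber_twist m wz' (ne (- r)); rewrite scaleNr addrK.
have z0 := fiber_torus xz.
have yz := fiber_twist m xz (ne s).
have rt : root (line_poly f m z) (e r).
  rewrite (line_poly_root f m z0 (e0 r)).
  have -> : twist z m (e r) = z'.
    rewrite /z -twistM; have -> : e (- r) * e r = 1.
      by rewrite -rmorphM /= -expRD addNr expR0.
    exact: twist1.
  by rewrite fz'; exact: eqxx.
have scE : disk_roots (line_poly f m (twist z m (e s))) =
    count (fun r => `|r| < e s) (poly_roots (line_poly f m z)).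
  have c0 : (e s ^+ line_shift f m)^-1 != 0.
    rewrite invr_eq0; exact: expf_neq0 (e0 s).
  have es0 : 0 < e s by exact: (etrans (ltcR 0 (expR s)) (expR_gt0 s)).
  exact: (etrans (congr1 (@disk_roots _) (line_poly_twist m z0 (e0 s)))
    (disk_roots_scale (line_poly_neq0 m fx xz) c0 es0)).
have cE := posz_subI (etrans (esym (order_fiber m fx xz))
  (etrans xy (order_fiber m fy yz))).
have {scE}cE : count (fun r => `|r| < 1) (poly_roots (line_poly f m z)) =
    count (fun r => `|r| < e s) (poly_roots (line_poly f m z)).
  exact: (etrans cE scE).
have [rls|rs'] := ltP r s; last first.
  have rE : r = s by apply/eqP; rewrite eq_le rs rs'.
  by apply: fy; rewrite -rE; apply/amoebaP; exists z'.
have er : e r \in poly_roots (line_poly f m z).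
  by rewrite (mem_poly_roots _ (line_poly_neq0 m fx xz)) rt.
have le1 (b : R[i]) : `|b| < 1 -> `|b| < e s.
  move=> b1; apply: lt_le_trans b1 _.
  exact: (etrans (complexr_ge1 _) (etrans (expR_ge1 s) (le_trans r0 rs))).
have ers : `|e r| < e s.
  by rewrite (ne r); exact: (etrans (ltcR _ _) (etrans (ltr_expR _ _) rls)).
have := eq_count_sub le1 cE er ers; rewrite (ne r).
by rewrite complexr_lt1 expR_lt1 ltNge r0.
Qed.

End Order.

(** * Components as level sets of an abstract order map *)

Section OrderClasses.
Variables (R : realType) (n : nat) (A : set 'rV[R]_n).
Variable o : 'rV[int]_n -> 'rV[R]_n -> int.
Implicit Types (m : 'rV[int]_n) (x y : 'rV[R]_n).
Local Notation dir m := (map_mx (intr : int -> R) m).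
Hypothesis oA : open (~` A).
Hypothesis o_lc : forall m x, ~ A x -> \forall y \near x, o m y = o m x.
Hypothesis o_same : forall x y, ~ A x -> ~ A y ->
  (forall i, o (delta_mx 0 i) x = o (delta_mx 0 i) y) ->
  forall m, o m x = o m y.
Variable b : 'rV[int]_n -> nat.
Hypothesis o_fin : forall m, exists D : nat, forall x, ~ A x ->
  exists2 d : nat, (d < D)%N & o m x = d%:Z - (b m)%:Z.
Hypothesis o_seg : forall x m (s r : R), ~ A x -> ~ A (x + s *: dir m) ->
  o m x = o m (x + s *: dir m) -> 0 <= r <= s -> ~ A (x + r *: dir m).

(** The direction y - x is approximated by m/q with error v. Moving the ends to x - t v and y + (1 -
    t) v makes the direction exactly m/q, keeps the orders when q is large, and leaves the point at
    parameter t where it was, so the result for integer directions applies to it. *)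
Lemma class_segment x y (t : R) : ~ A x -> ~ A y ->
  (forall i, o (delta_mx 0 i) x = o (delta_mx 0 i) y) ->
  0 <= t <= 1 -> ~ A ((1 - t) *: x + t *: y).
Proof.
move=> fx fy xy t01.
have near_class w : ~ A w -> \forall u \near w, ~ A u /\
    forall i, o (delta_mx 0 i) u = o (delta_mx 0 i) w.
  move=> fw; apply: filterS2 (_ : nbhs w (~` A)) (near_mem_seq
    (enum 'I_n) (fun i => o_lc (delta_mx 0 i) fw)).
    by move=> u fu uw; split=> // i; apply: uw; rewrite mem_enum.
  by have := oA; rewrite openE => /(_ w fw).
have /nbhs_ballP[d /= d0 dx] := near_class x fx.
have /nbhs_ballP[d' /= d'0 dy] := near_class y fy.
pose q := (Num.truncn (d^-1 + d'^-1)).+1.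
have q0 : 0 < q%:R :> R by rewrite ltr0n.
have dq (c : R) : 0 < c -> c^-1 <= d^-1 + d'^-1 -> q%:R^-1 < c.
  move=> c0 cd; rewrite invf_plt ?posrE //; apply: le_lt_trans cd _.
  exact: truncnS_gt.
have qd : q%:R^-1 < d by apply: dq => //; rewrite lerDl invr_ge0 ltW.
have qd' : q%:R^-1 < d' by apply: dq => //; rewrite lerDr invr_ge0 ltW.
pose m : 'rV[int]_n := \row_i Num.floor (q%:R * (y 0 i - x 0 i)).
pose v : 'rV[R]_n := q%:R^-1 *: dir m - (y - x).
have v_le i : `|v 0 i| <= q%:R^-1.
  rewrite !mxE; set c := y 0 i - x 0 i.
  have /andP[f1 f2] := floor_itv (q%:R * c).
  have -> : q%:R^-1 * (Num.floor (q%:R * c))%:~R - c =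
      - (q%:R^-1 * (q%:R * c - (Num.floor (q%:R * c))%:~R)).
    by field; rewrite gt_eqF.
  rewrite normrN normrM (gtr0_norm (_ : 0 < q%:R^-1)) ?invr_gt0 //.
  rewrite ler_piMr ?invr_ge0 ?ltW // ger0_norm ?subr_ge0 //.
  by move: f2; rewrite rmorphD /= => f2; lra.
have [t0 t1] := andP t01.
have vE : q%:R^-1 *: dir m = (y - x) + v by rewrite addrC subrK.
clearbody v; pose x1 := x - t *: v; pose y1 := y + (1 - t) *: v.
have yx1 : y1 = x1 + q%:R^-1 *: dir m.
  by rewrite vE; apply/rowP => i; rewrite !mxE; ring.
have rV_ball (w u : 'rV[R]_n) (c : R) : 0 < c ->
    (forall i, `|w 0 i - u 0 i| < c) -> ball w c u.
  by move=> c0 wu; split=> // i j; rewrite ord1; exact: wu.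
have [fx1 ox1] : ~ A x1 /\
    forall i, o (delta_mx 0 i) x1 = o (delta_mx 0 i) x.
  apply: dx; apply: rV_ball => // i.
  have -> : x 0 i - x1 0 i = t * v 0 i by rewrite !mxE; ring.
  by rewrite normrM ger0_norm // (le_lt_trans _ qd) // (le_trans _ (v_le i)) // ler_piMl.
have [fy1 oy1] : ~ A y1 /\
    forall i, o (delta_mx 0 i) y1 = o (delta_mx 0 i) y.
  apply: dy; apply: rV_ball => // i.
  have -> : y 0 i - y1 0 i = - ((1 - t) * v 0 i) by rewrite !mxE; ring.
  rewrite normrN normrM ger0_norm ?subr_ge0 // (le_lt_trans _ qd') //.
  by rewrite (le_trans _ (v_le i)) // ler_piMl // lerBlDr lerDl.
have om : o m x1 = o m (x1 + q%:R^-1 *: dir m).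
  rewrite -yx1; apply: (o_same fx1 fy1) => i.
  exact: (etrans (ox1 i) (etrans (xy i) (esym (oy1 i)))).
have fy1' : ~ A (x1 + q%:R^-1 *: dir m) by rewrite -yx1.
have tq : 0 <= t / q%:R <= q%:R^-1.
  have qi0 : 0 <= q%:R^-1 :> R by rewrite invr_ge0 ltW.
  by rewrite mulr_ge0 //= ler_piMl.
have := o_seg fx1 fy1' om tq.
suff -> : x1 + (t / q%:R) *: dir m = (1 - t) *: x + t *: y by [].
by rewrite -scalerA vE; apply/rowP => i; rewrite !mxE; ring.
Qed.

(** Orders are constant on connected sets; conversely, points of equal order are joined by a segment
    in the complement. *)
Lemma component_class x y : ~ A x ->
  connected_component (~` A) x y <-> ~ A y /\
    forall i, o (delta_mx 0 i) x = o (delta_mx 0 i) y.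
Proof.
move=> fx; split=> [xy|[fy xy]].
  have fy : ~ A y by exact: (connected_component_sub xy).
  split=> // i; apply: (connected_locally_constant
    (component_connected (A := ~` A) (x := x)) _ _ xy).
    move=> w /connected_component_sub fw.
    by apply: filterS (o_lc (delta_mx 0 i) fw).
  exact: connected_component_refl.
pose g (t : R) := (1 - t) *: x + t *: y.
apply: (@connected_component_max _ _ (g @` `[0, 1]%classic)).
- by exists 0; rewrite /= ?in_itv /= ?lexx ?ler01 // /g subr0 scale1r scale0r addr0.
- move=> _ [t tI <-]; move: tI; rewrite /= in_itv /= => t01.
  exact: class_segment.
- apply: connected_continuous_connected; first exact: segment_connected.
  apply: continuous_subspaceT => t; apply: cvgD; apply: cvgZr_tmp.
    by apply: cvgB; [exact: cvg_cst|exact: cvg_id].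
  exact: cvg_id.
by exists 1; rewrite /= ?in_itv /= ?lexx ?ler01 // /g subrr scale1r scale0r add0r.
Qed.

Lemma component_open x : open (connected_component (~` A) x).
Proof.
rewrite openE => y xy; have fy := connected_component_sub xy.
have fx : ~ A x.
  by apply: contrapT => fx; move: xy; rewrite connected_component_out.
have [_ oxy] := (component_class y fx).1 xy.
have lc : \forall w \near y, forall i, i \in enum 'I_n ->
    o (delta_mx 0 i) w = o (delta_mx 0 i) y.
  by apply: near_mem_seq => i; exact: o_lc.
have := oA; rewrite openE => /(_ y fy) Ay.
apply: filterS2 lc Ay => w lw fw.
apply/(component_class w fx); split=> // i.
by rewrite (oxy i) (lw i) // mem_enum.
Qed.

Lemma component_convex x :
  @convex_set R 'rV[R]_n (connected_component (~` A) x).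
Proof.
apply/convex_setP => y z t t0 t1 xy xz.
have fx : ~ A x.
  by apply: contrapT => fx; move: xy; rewrite connected_component_out.
have [fy oy] := (component_class y fx).1 xy.
have [fz oz] := (component_class z fx).1 xz.
have ozy i : o (delta_mx 0 i) z = o (delta_mx 0 i) y.
  exact: (etrans (esym (oz i)) (oy i)).
have seg s : 0 <= s <= 1 -> ~ A ((1 - s) *: z + s *: y).
  exact: class_segment.
have -> : t *: y + (1 - t) *: z = (1 - t) *: z + t *: y by rewrite addrC.
have t01 : 0 <= t <= 1 by rewrite t0 t1.
apply: (connected_component_trans xz).
pose g (s : R) := (1 - s) *: z + s *: y.
apply: (@connected_component_max _ _ (g @` `[0, 1]%classic)).
- by exists 0; rewrite /= ?in_itv /= ?lexx ?ler01 // /g subr0 scale1r scale0r addr0.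
- by move=> _ [s sI <-]; move: sI; rewrite /= in_itv /=; exact: seg.
- apply: connected_continuous_connected; first exact: segment_connected.
  apply: continuous_subspaceT => s; apply: cvgD; apply: cvgZr_tmp.
    by apply: cvgB; [exact: cvg_cst|exact: cvg_id].
  exact: cvg_id.
by exists t; rewrite //= in_itv.
Qed.

Lemma near_unique_class p E : is_component (~` A) E ->
  (forall E', is_component (~` A) E' -> closure E' p -> E' = E) ->
  \forall x \near p, ~ A x -> E x.
Proof.
move=> cE uE.
have /choice[D DP] := fun i : 'I_n => o_fin (delta_mx 0 i).
pose M := (\sum_i D i)%N.
(* Shifted by [b], the orders are natural numbers bounded by [M], so order vectors are coded by a
   finite type. The class of a code, if non-empty, is a component that is either E or away from
   p. *)
pose u x i := o (delta_mx 0 i) x + (b (delta_mx 0 i))%:Z.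
have near_code (h : {ffun 'I_n -> 'I_M.+1}) : \forall x \near p,
    ~ A x -> (forall i, u x i = (h i)%:Z) -> E x.
  have [[y [fy yh]]|ny] := pselect (exists y, ~ A y /\
      forall i, u y i = (h i)%:Z); last first.
    apply: (@filterE _ (nbhs p) (@nbhs_filter _ p)) => x fx xh.
    by case: ny; exists x.
  pose E' := connected_component (~` A) y.
  have cE' : is_component (~` A) E' by exists y.
  have xE' x : ~ A x -> (forall i, u x i = (h i)%:Z) -> E' x.
    move=> fx xh; apply/(component_class x fy); split=> // i.
    apply: (addIr (b (delta_mx 0 i))%:Z).
    exact: (etrans (yh i) (esym (xh i))).
  have [pE'|npE'] := pselect (closure E' p).
    rewrite -(uE E' cE' pE').
    exact: (@filterE _ (nbhs p) (@nbhs_filter _ p)).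
  have : nbhs p (~` E').
    apply: contrapT => nn; apply: npE' => B Bp; apply: contrapT => nB; apply: nn.
    apply: filterS Bp => w Bw Ew; apply: nB; exists w; split=> //.
  by apply: filterS => x nx fx xh; case: nx; exact: xE'.
have : \forall x \near p, forall h, h \in enum {: {ffun 'I_n -> 'I_M.+1}} ->
    ~ A x -> (forall i, u x i = (h i)%:Z) -> E x.
  by apply: near_mem_seq => h; exact: near_code.
apply: filterS => x H fx.
have /choice[d dP] : forall i, exists d : 'I_M.+1, u x i = d%:Z.
  move=> i; have [d dD od] := DP i x fx.
  have dM : (d < M.+1)%N.
    by rewrite ltnS ltnW // (leq_trans dD) // /M (bigD1 i) //= leq_addr.
  exists (Ordinal dM); rewrite /u /=.
  by rewrite od subrK.
apply: (H [ffun i => d i]) => //; first by rewrite mem_enum.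
by move=> i; rewrite ffunE dP.
Qed.

End OrderClasses.

Section AmoebaComplement.
Variables (R : realType) (n : nat) (f : laurent R n).
Implicit Types (x p : 'rV[R]_n) (E : set 'rV[R]_n).

Lemma component_amoebaC_open x : open (connected_component (~` amoeba f) x).
Proof.
exact: (component_open (@open_amoebaC R n f) (@order_locally_constant R n f)
  (@order_same R n f) (@order_segment R n f)).
Qed.

Lemma component_amoebaC_convex x :
  @convex_set R 'rV[R]_n (connected_component (~` amoeba f) x).
Proof.
exact: (component_convex (@open_amoebaC R n f) (@order_locally_constant R n f)
  (@order_same R n f) (@order_segment R n f)).
Qed.

(* Finitely many orders occur, so no other component accumulates at p. *)
Lemma near_unique_component p E : is_component (~` amoeba f) E ->
  (forall E', is_component (~` amoeba f) E' -> closure E' p -> E' = E) ->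
  \forall x \near p, ~ amoeba f x -> E x.
Proof.
exact: (near_unique_class (@open_amoebaC R n f) (@order_locally_constant R n f)
  (@order_same R n f) (@order_map_finite R n f) (@order_segment R n f)).
Qed.

End AmoebaComplement.

(** * Semialgebraic subsets of the line *)

Section Definable.
Variable R : rcfType.
Local Notation env := (nat -> R).
Implicit Types (e : env) (P Q : env -> Prop) (g h : env -> R) (i : nat) (r : R).

Definition env_upd e i r : env := fun j => if j == i then r else e j.

(** Terms without inversion. Agreement is asked only at environments that vanish from some index on,
    the ones that lists represent. *)
Definition poly_fun g := exists t : GRing.term R, GRing.rterm t /\
  forall s : seq R, GRing.eval s t = g (nth 0 s).

(* Semialgebraic sets of environments, as first-order formulas. *)
Definition definable P := exists2 phi : ordered_qelim.ord.formula R,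
  ordered_qelim.ord.rformula phi &
  forall s : seq R, ordered_qelim.ord.holds s phi <-> P (nth 0 s).

Lemma poly_fun_var i : poly_fun (fun e => e i).
Proof. by exists (GRing.Var R i). Qed.

Lemma poly_fun_cst r : poly_fun (fun=> r).
Proof. by exists (GRing.Const r). Qed.

Lemma poly_funD g h : poly_fun g -> poly_fun h -> poly_fun (fun e => g e + h e).
Proof.
by move=> [t [rt tg]] [u [ru uh]]; exists (GRing.Add t u); rewrite /= rt ru;
  split=> // s; rewrite tg uh.
Qed.

Lemma poly_funM g h : poly_fun g -> poly_fun h -> poly_fun (fun e => g e * h e).
Proof.
by move=> [t [rt tg]] [u [ru uh]]; exists (GRing.Mul t u); rewrite /= rt ru;
  split=> // s; rewrite tg uh.
Qed.

Lemma poly_funN g : poly_fun g -> poly_fun (fun e => - g e).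
Proof.
by move=> [t [rt tg]]; exists (GRing.Opp t); rewrite /= rt; split=> // s; rewrite tg.
Qed.

Lemma poly_funB g h : poly_fun g -> poly_fun h -> poly_fun (fun e => g e - h e).
Proof. by move=> pg ph; apply: poly_funD => //; exact: poly_funN. Qed.

Lemma definable_eq g h : poly_fun g -> poly_fun h -> definable (fun e => g e = h e).
Proof.
move=> [t [rt tg]] [u [ru uh]]; exists (ordered_qelim.ord.Equal t u).
  by rewrite /= rt ru.
by move=> s; rewrite /= tg uh.
Qed.

Lemma definable_lt g h : poly_fun g -> poly_fun h ->
  definable (fun e => g e < h e).
Proof.
move=> [t [rt tg]] [u [ru uh]]; exists (ordered_qelim.ord.Lt t u).
  by rewrite /= rt ru.
by move=> s; rewrite /= tg uh.
Qed.

Lemma definable_and P Q : definable P -> definable Q ->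
  definable (fun e => P e /\ Q e).
Proof.
move=> [t rt tP] [u ru uQ]; exists (ordered_qelim.ord.And t u).
  by rewrite /= rt ru.
by move=> s; rewrite /= tP uQ.
Qed.

Lemma definable_imp P Q : definable P -> definable Q ->
  definable (fun e => P e -> Q e).
Proof.
move=> [t rt tP] [u ru uQ]; exists (ordered_qelim.ord.Implies t u).
  by rewrite /= rt ru.
by move=> s; rewrite /= tP uQ.
Qed.

Lemma definable_not P : definable P -> definable (fun e => ~ P e).
Proof.
move=> [t rt tP]; exists (ordered_qelim.ord.Not t) => //.
by move=> s; rewrite /= tP.
Qed.

Lemma definable_ext P Q : (forall e, P e <-> Q e) -> definable P -> definable Q.
Proof. by move=> PQ [t rt tP]; exists t => // s; rewrite tP. Qed.

Lemma nth_env_upd (s : seq R) i r : nth 0 (set_nth 0 s i r) = env_upd (nth 0 s) i r.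
Proof. by apply/funext => j; rewrite nth_set_nth. Qed.

Lemma definable_ex i P : definable P ->
  definable (fun e => exists r, P (env_upd e i r)).
Proof.
move=> [t rt tP]; exists (ordered_qelim.ord.Exists i t) => // s /=.
by split=> -[r] => [/tP|]; exists r; [rewrite -nth_env_upd | apply/tP; rewrite nth_env_upd].
Qed.

Lemma definable_all i P : definable P ->
  definable (fun e => forall r, P (env_upd e i r)).
Proof.
move=> [t rt tP]; exists (ordered_qelim.ord.Forall i t) => // s /=.
by split=> H r; [rewrite -nth_env_upd; exact/tP | apply/tP; rewrite nth_env_upd].
Qed.

Definition env_upds e (js : seq nat) (w : nat -> R) : env :=
  fun j => if j \in js then w j else e j.

Lemma definable_ex_seq (js : seq nat) P : definable P ->
  definable (fun e => exists w, P (env_upds e js w)).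
Proof.
elim: js P => [|j js IH] P dP.
  apply: definable_ext dP => e; have -> : env_upds e [::] = fun=> e by [].
  by split=> [|[]//]; exists e.
apply: (definable_ext _ (IH _ (definable_ex j dP))) => e; split.
  move=> [w [r Pr]]; exists (env_upd w j r).
  congr (P _): Pr; apply/funext => i; rewrite /env_upd /env_upds inE.
  by case: eqP.
move=> [w Pw]; exists w; exists (w j).
congr (P _): Pw; apply/funext => i; rewrite /env_upd /env_upds inE.
by case: eqP => [->|].
Qed.

Lemma definable_forall_ord n (P : 'I_n -> env -> Prop) :
  (forall l, definable (P l)) -> definable (fun e => forall l, P l e).
Proof.
move=> dP; suff H (s : seq 'I_n) : definable (fun e => forall l, l \in s -> P l e).
  apply: definable_ext (H (enum 'I_n)) => e; split=> Pe i => [|_]; last exact: Pe.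
  by apply: Pe; rewrite mem_enum.
elim: s => [|i s IH].
  by exists (ordered_qelim.ord.Bool true).
apply: definable_ext (definable_and (dP i) IH) => e; split.
  by move=> [Pi Ps] j; rewrite inE => /orP[/eqP -> //|]; exact: Ps.
move=> H; split; first by apply: H; rewrite mem_head.
by move=> j js; apply: H; rewrite inE js orbT.
Qed.

End Definable.

(** * Definable sets of one variable *)

Section DefinableLine.
Variable R : realType.

Lemma rterm_poly (t : GRing.term R) : GRing.rterm t ->
  exists p : {poly R}, forall r, GRing.eval [:: r] t = p.[r].
Proof.
elim: t => //=.
- case=> [|i] _; first by exists 'X => r; rewrite hornerX.
  by exists 0 => r; rewrite horner0 /= nth_nil.
- by move=> c _; exists c%:P => r; rewrite hornerC.
- by move=> k _; exists k%:R => r; rewrite -polyC_natr hornerC.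
- move=> t IHt u IHu /andP[/IHt[p tp] /IHu[q uq]].
  by exists (p + q) => r; rewrite hornerD tp uq.
- by move=> t IHt /IHt[p tp]; exists (- p) => r; rewrite hornerN tp.
- by move=> t IHt k /IHt[p tp]; exists (p *+ k) => r; rewrite hornerMn tp.
- move=> t IHt u IHu /andP[/IHt[p tp] /IHu[q uq]].
  by exists (p * q) => r; rewrite hornerM tp uq.
- by move=> t IHt k /IHt[p tp]; exists (p ^+ k) => r; rewrite horner_exp tp.
Qed.

(** The exceptional points are carried by a polynomial, so that connectives just multiply
    polynomials. *)
Definition tame (b : R -> bool) := exists2 q : {poly R}, q != 0 &
  forall r, ~~ root q r -> \forall u \near r, b u = b r.

Lemma tame_cst (c : bool) : tame (fun=> c).
Proof.
exists 1; first exact: oner_neq0.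
by move=> r _; apply: (@filterE R (nbhs r)).
Qed.

Lemma tame_ext b c : b =1 c -> tame b -> tame c.
Proof. by move=> /funext ->. Qed.

Lemma tame_sign (p : {poly R}) :
  tame (fun r => 0 < p.[r]) /\ tame (fun r => p.[r] == 0).
Proof.
have [->|p0] := eqVneq p 0.
  split; [apply: tame_ext (tame_cst false)|apply: tame_ext (tame_cst true)];
  by move=> r /=; rewrite horner0 ?ltxx ?eqxx.
have pos (q : {poly R}) r : 0 < q.[r] -> \forall u \near r, 0 < q.[u].
  move=> qr; have := @continuous_horner R q r.
  by move/cvgr_gt; apply.
split; exists p => // r rp.
  have [pr|pr|pr] := ltgtP 0 p.[r].
  - by apply: filterS (pos p r pr) => u ->.
  - have : 0 < (- p).[r] by rewrite hornerN oppr_gt0.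
    by move/pos; apply: filterS => u; rewrite hornerN oppr_gt0 => /lt_gtF ->.
  - by move: rp; rewrite /root -pr eqxx.
have [pr|pr|pr] := ltgtP 0 p.[r].
- by apply: filterS (pos p r pr) => u pu; rewrite !gt_eqF.
- have : 0 < (- p).[r] by rewrite hornerN oppr_gt0.
  by move/pos; apply: filterS => u; rewrite hornerN oppr_gt0 => pu; rewrite !lt_eqF.
- by move: rp; rewrite /root -pr eqxx.
Qed.

Lemma tame2 (op : bool -> bool -> bool) b c : tame b -> tame c ->
  tame (fun r => op (b r) (c r)).
Proof.
move=> [p p0 bp] [q q0 cq]; exists (p * q); first by rewrite mulf_neq0.
move=> r; rewrite rootM negb_or => /andP[/bp rb /cq rc].
by apply: filterS2 rb rc => u -> ->.
Qed.

Lemma tame_qf (phi : ordered_qelim.ord.formula R) :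
  ordered_qelim.ord.qf_form phi -> ordered_qelim.ord.rformula phi ->
  tame (fun r => @ordered_qelim.ord.qf_eval R [:: r] phi).
Proof.
elim: phi => //=.
- by move=> b _ _; exact: tame_cst.
- move=> t u _ /andP[/rterm_poly[p tp] /rterm_poly[q uq]].
  apply: tame_ext (tame_sign (p - q)).2 => r /=.
  by rewrite hornerD hornerN subr_eq0 tp uq.
- move=> t u _ /andP[/rterm_poly[p tp] /rterm_poly[q uq]].
  apply: tame_ext (tame_sign (q - p)).1 => r /=.
  by rewrite hornerD hornerN subr_gt0 tp uq.
- move=> t u _ /andP[/rterm_poly[p tp] /rterm_poly[q uq]].
  have := tame2 (fun a b => a || b) (tame_sign (q - p)).1 (tame_sign (q - p)).2.
  apply: tame_ext => r /=.
  by rewrite hornerD hornerN subr_gt0 subr_eq0 tp uq orbC eq_sym -le_eqVlt.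
- move=> f IHf g IHg /andP[qf qg] /andP[rf rg].
  exact: (tame2 andb (IHf qf rf) (IHg qg rg)).
- move=> f IHf g IHg /andP[qf qg] /andP[rf rg].
  exact: (tame2 orb (IHf qf rf) (IHg qg rg)).
- move=> f IHf g IHg /andP[qf qg] /andP[rf rg].
  exact: (tame2 implb (IHf qf rf) (IHg qg rg)).
- move=> f IHf qf rf.
  exact: (tame2 (fun a _ => ~~ a) (IHf qf rf) (IHf qf rf)).
Qed.

(** Quantifier elimination over a real closed field leaves sign conditions on polynomials in
    variable 0; all other variables read 0 in [[:: r]]. *)
Lemma definable_line (P : (nat -> R) -> Prop) : definable P ->
  exists2 b : R -> bool, tame b & forall r, b r <-> P (nth 0 [:: r]).
Proof.
move=> [phi rphi phiP].
pose w i bc := qe_rcf.qfr_to_formula (@qe_rcf.wproj R i bc).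
pose psi := ordered_qelim.ord.quantifier_elim w phi.
have /andP[qpsi rpsi] : ordered_qelim.ord.qf_form psi && ordered_qelim.ord.rformula psi.
  exact: (ordered_qelim.ord.quantifier_elim_wf (wproj := w) (@qe_rcf.wf_QE_wproj R)).
exists (fun r => @ordered_qelim.ord.qf_eval R [:: r] psi); first exact: tame_qf.
move=> r; rewrite -phiP.
have psiP := ordered_qelim.ord.quantifier_elim_rformP (wproj := w)
  (@qe_rcf.wf_QE_wproj R) (@qe_rcf.valid_QE_wproj R) [:: r] rphi.
by split=> h; [exact: elimT psiP h|exact: introT psiP h].
Qed.

(* The finitely many exceptional points aside, membership is locally constant. *)
Lemma definable_line_infinite (P : (nat -> R) -> Prop) : definable P ->
  ~ finite_set [set r | P (nth 0 [:: r])] ->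
  exists a b, a < b /\ forall r, a <= r <= b -> P (nth 0 [:: r]).
Proof.
move=> /definable_line[c [q q0 cq] cP] infP.
have [r rq cr] : exists2 r, ~~ root q r & c r.
  apply: contrapT => nr; apply: infP.
  apply: (@sub_finite_set _ _ [set` polyrcf.rootsR q]).
    move=> r /cP cr; rewrite /=.
    rewrite -(polyrcf.roots_on_rootsR q0) ?inE //=.
    by apply: contrapT => /negP rq; apply: nr; exists r.
  exact: finite_seq.
have /nbhs_ballP[e /= e0 He] := cq r rq.
exists (r - e / 2), (r + e / 2); split; first by lra.
move=> u /andP[u1 u2]; apply/cP; rewrite He // /ball /=.
by rewrite ltr_norml; lra.
Qed.

End DefinableLine.

(** * Finiteness of the set of vertices *)

Section Hausdorff.
Variables (R : realType) (n : nat).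
Implicit Types (S : set 'rV[R]_n).

Lemma interval_cover_length (a b : R) (c r : nat -> R) : a <= b ->
  (forall k, 0 < r k) ->
  `[a, b]%classic `<=` \bigcup_k ball (c k) (r k) ->
  ((b - a)%:E <= \sum_(0 <= k <oo) (2 * r k)%:E)%E.
Proof.
move=> ab r0 cover.
have -> : (b - a)%:E = lebesgue_measure `[a, b]%classic.
  rewrite lebesgue_measure_itv /= lte_fin EFinB.
  by move: ab; rewrite le_eqVlt => /orP[/eqP <-|->//]; rewrite ltxx subee.
apply: le_trans (_ : (\sum_(0 <= k <oo)
    lebesgue_measure (ball (c k) (r k) : set (measurableTypeR R)) <= _)%E).
  by apply: measure_sigma_subadditive => // k; rewrite ball_itv; exact: measurable_itv.
apply: lee_nneseries => // k _.
by rewrite (lebesgue_measure_ball _ (ltW (r0 k))) mulr_natl lexx.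
Qed.

(** Dimension 0 provides an exponent s < 1 of zero content. Coordinate projections map balls of the
    max norm into intervals of the same radius, so a cover of S would cover [a, b] by intervals of
    too small total length. *)
Lemma hausdorff_dim0_coord S i (a b : R) : S !=set0 ->
  hausdorff_dim S = 0%E -> a < b ->
  ~ (`[a, b]%classic `<=` [set x 0 i | x in S]).
Proof.
move=> S0 dS ab abS.
have : (hausdorff_dim S < 1%:E)%E by rewrite dS lte_fin.
move/ereal_inf_lt => [_ [s [s0 cs] <-]]; rewrite lte_fin => s1.
(* The bound 1 forces r_k <= 1, hence r_k <= r_k^s; the half compensates for the length 2 r_k of an
   interval of radius r_k. *)
pose e := Num.min 1 ((b - a) / 2).
have e0 : 0 < e by rewrite lt_min ltr01 /=; lra.
have : (hausdorff_content s S < e%:E)%E by rewrite cs lte_fin.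
move/ereal_inf_lt => [_ [c [r [r0 Scov ->]]]] sumlt.
have powr_ge0 k : (0 <= (r k `^ s)%:E)%E by rewrite lee_fin powR_ge0.
have term k : r k `^ s < e.
  rewrite -lte_fin; apply: le_lt_trans sumlt.
  rewrite (@nneseriesD1 _ (fun k => (r k `^ s)%:E) k) // leeDl //.
  by apply: nneseries_ge0.
have r1 k : r k <= 1.
  rewrite leNgt; apply/negP => rk.
  have : 1 `^ s <= r k `^ s.
    by apply: ge0_ler_powR => //; rewrite ?nnegrE ?ltW.
  rewrite powR1 leNgt => /negP; apply; apply: lt_le_trans (term k) _.
  by rewrite ge_min lexx.
have rs k : r k <= r k `^ s.
  have rk : 0 < r k <= 1 by rewrite r0 r1.
  by have := ger_powR rk (ltW s1); rewrite powRr1 // ltW.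
have := @interval_cover_length a b (fun k => c k 0 i) r (ltW ab) r0.
have cover : `[a, b]%classic `<=` \bigcup_k ball (c k 0 i) (r k).
  move=> x /abS[v /Scov[k _ [_ vk]] <-]; exists k => //; exact: vk.
move=> /(_ cover); apply/negP; rewrite -ltNge.
apply: le_lt_trans (_ : (\sum_(0 <= k <oo) (2%:E * (r k `^ s)%:E) < _)%E).
  apply: lee_nneseries => [k _|k _]; last by rewrite -EFinM lee_fin ler_pM2l.
  by rewrite lee_fin mulr_ge0 // ltW.
rewrite nneseriesZl //.
have -> : (b - a)%:E = (2%:E * ((b - a) / 2)%:E)%E.
  by rewrite -EFinM mulrC divfK.
rewrite lte_pmul2l ?lte_fin //; apply: lt_le_trans sumlt _.
by rewrite lee_fin ge_min lexx orbT.
Qed.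

End Hausdorff.

Lemma finite_coords (R : realType) n (S : set 'rV[R]_n) :
  (forall i, finite_set [set x 0 i | x in S]) -> finite_set S.
Proof.
move=> fS.
have /choice[s sP] : forall i : 'I_n, exists s : seq R,
    [set x 0 i | x in S] = [set` s].
  by move=> i; have /finite_seqP := fS i.
pose t := flatten [seq s i | i : 'I_n].
have tP x i : S x -> x 0 i \in t.
  move=> Sx; apply/flattenP; exists (s i); first by apply/mapP; exists i; rewrite ?mem_enum.
  have : [set x 0 i | x in S] (x 0 i) by exists x.
  by rewrite sP.
pose g (h : {ffun 'I_n -> 'I_(size t)}) : 'rV[R]_n := \row_i t`_(h i).
apply: (@sub_finite_set _ _ (g @` setT)); last first.
  by apply: finite_image; exact: finite_finset.
move=> x Sx; have ti (i : 'I_n) : (index (x ord0 i) t < size t)%N by rewrite index_mem tP.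
exists [ffun i => Ordinal (ti i)] => //.
by apply/rowP => i; rewrite mxE ffunE /= nth_index // tP.
Qed.

Section Blocks.
Variables (R : realType) (n : nat).
Implicit Types (e : nat -> R) (v w : 'I_n -> R) (i j l : 'I_n) (k : nat).

(* Variable 0 is the projected coordinate, variable 1 the tolerance, and the
   blocks hold a point, a nearby point, and the real and imaginary parts of a
   point of the fibre. *)
Definition bvar k i : nat := (k * n + i).+2.

Lemma bvar_inj k k' i j : bvar k i = bvar k' j -> k = k' /\ i = j.
Proof.
move=> [/eqP]; rewrite /bvar => /eqP h.
have := congr1 (fun m => m %/ n)%N h; have := congr1 (fun m => m %% n)%N h.
have n0 : (0 < n)%N by exact: leq_ltn_trans (ltn_ord i).
rewrite !modnMDl !modn_small // => ij.
rewrite !divnMDl // !divn_small // !addn0 => ->.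
by split=> //; exact: val_inj.
Qed.

Definition bupd e k v : nat -> R := fun m =>
  if [pick i | bvar k i == m] is Some i then v i else e m.

Lemma bupdE e k v k' i :
  bupd e k v (bvar k' i) = if k == k' then v i else e (bvar k' i).
Proof.
rewrite /bupd; case: pickP => [j /eqP/bvar_inj[-> ->]|h]; first by rewrite eqxx.
by case: eqP => // kk; have := h i; rewrite kk eqxx.
Qed.

Lemma bupd_low e k v m : (m < 2)%N -> bupd e k v m = e m.
Proof.
by rewrite /bupd; case: pickP => // j /eqP <-.
Qed.

Lemma definable_bex k (P : (nat -> R) -> Prop) : definable P ->
  definable (fun e => exists v, P (bupd e k v)).
Proof.
move=> dP; pose js := [seq bvar k i | i : 'I_n].
have jsP m : (m \in js) = [exists i, bvar k i == m].
  apply/mapP/existsP => -[l]; first by move=> _ ->; exists l.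
  by move=> /eqP <-; exists l; rewrite ?mem_enum.
apply: definable_ext (definable_ex_seq js dP) => e; split=> [[w Pw]|[v Pv]].
  exists (fun i => w (bvar k i)); congr (P _): Pw; apply/funext => m.
  rewrite /env_upds /bupd jsP; case: pickP => [i /eqP im|h].
    by rewrite -im; case: existsP => // -[]; exists i.
  by case: existsP => // -[l]; rewrite h.
exists (bupd e k v); congr (P _): Pv; apply/funext => m.
rewrite /env_upds /bupd jsP; case: pickP => [i /eqP im|h].
  by rewrite -im; case: existsP => // -[]; exists i.
by case: ifP.
Qed.

Definition cpoly_fun (g : (nat -> R) -> R[i]) :=
  poly_fun (fun e => complex.Re (g e)) /\ poly_fun (fun e => complex.Im (g e)).

Lemma poly_fun_ext (g h : (nat -> R) -> R) : g =1 h -> poly_fun g -> poly_fun h.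
Proof. by move=> /funext ->. Qed.

Lemma cpoly_fun_cst c : cpoly_fun (fun=> c).
Proof. by split; exact: poly_fun_cst. Qed.

Lemma cpoly_funD g h : cpoly_fun g -> cpoly_fun h -> cpoly_fun (fun e => g e + h e).
Proof.
move=> [g1 g2] [h1 h2]; split.
  by apply: poly_fun_ext (poly_funD g1 h1) => e; case: (g e) (h e) => ? ? [].
by apply: poly_fun_ext (poly_funD g2 h2) => e; case: (g e) (h e) => ? ? [].
Qed.

Lemma cpoly_funM g h : cpoly_fun g -> cpoly_fun h -> cpoly_fun (fun e => g e * h e).
Proof.
move=> [g1 g2] [h1 h2]; split.
  apply: poly_fun_ext (poly_funB (poly_funM g1 h1) (poly_funM g2 h2)) => e.
  by case: (g e) (h e) => ? ? [].
apply: poly_fun_ext (poly_funD (poly_funM g1 h2) (poly_funM g2 h1)) => e.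
by case: (g e) (h e) => ? ? [].
Qed.

Lemma cpoly_fun_sum (I : Type) (s : seq I) (F : I -> (nat -> R) -> R[i]) :
  (forall m, cpoly_fun (F m)) -> cpoly_fun (fun e => \sum_(m <- s) F m e).
Proof.
move=> dF; elim: s => [|m s IH].
  rewrite (_ : (fun e => _) = fun=> 0); first exact: cpoly_fun_cst.
  by apply/funext => e; rewrite big_nil.
rewrite (_ : (fun e => _) = fun e => F m e + \sum_(m <- s) F m e).
  exact: cpoly_funD.
by apply/funext => e; rewrite big_cons.
Qed.

Lemma cpoly_fun_prod (I : Type) (s : seq I) (F : I -> (nat -> R) -> R[i]) :
  (forall m, cpoly_fun (F m)) -> cpoly_fun (fun e => \prod_(m <- s) F m e).
Proof.
move=> dF; elim: s => [|m s IH].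
  rewrite (_ : (fun e => _) = fun=> 1); first exact: cpoly_fun_cst.
  by apply/funext => e; rewrite big_nil.
rewrite (_ : (fun e => _) = fun e => F m e * \prod_(m <- s) F m e).
  exact: cpoly_funM.
by apply/funext => e; rewrite big_cons.
Qed.

Lemma cpoly_funXn g m : cpoly_fun g -> cpoly_fun (fun e => g e ^+ m).
Proof.
move=> dg; elim: m => [|m IH].
  exact: cpoly_fun_cst.
rewrite (_ : (fun e => _) = fun e => g e * g e ^+ m); first exact: cpoly_funM.
by apply/funext => e; rewrite exprS.
Qed.

Lemma definable_ceq0 g : cpoly_fun g -> definable (fun e => g e = 0).
Proof.
move=> [g1 g2]; have d0 := poly_fun_cst (0 : R).
apply: definable_ext (definable_and (definable_eq g1 d0) (definable_eq g2 d0)).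
move=> e; case: (g e) => a b /=; split=> [[-> ->] //|].
by move=> h; split; [exact: (congr1 (@complex.Re R) h)|exact: (congr1 (@complex.Im R) h)].
Qed.

End Blocks.

(** * The exponential of the set of vertices is semialgebraic *)

Section ExpCoordinates.
Variables (R : realType) (n : nat).
Implicit Types (f : laurent R n) (x y : 'rV[R]_n) (r v p q : 'I_n -> R).

Definition exp_coords x : 'I_n -> R := fun i => expR (x 0 i).

Lemma exp_coordsP r : (forall i, 0 < r i) -> exists x, exp_coords x = r.
Proof.
move=> r0; exists (\row_i ln (r i)); apply/funext => i.
by rewrite /exp_coords mxE lnK // posrE.
Qed.

Lemma rV_ballP x (e : R) y : ball x e y <->
  0 < e /\ forall i, `|x 0 i - y 0 i| < e.
Proof.
split=> [[e0 xy]|[e0 xy]]; split=> // i; first exact: xy.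
by move=> j; rewrite ord1; exact: xy.
Qed.

Lemma closure_exp (B : set 'rV[R]_n) x : closure B x <->
  forall e, 0 < e -> exists2 y, B y & forall i,
    `|exp_coords y i - exp_coords x i| < e.
Proof.
split=> [Bx e e0|H U Ux].
  have : nbhs x [set y | forall i, i \in enum 'I_n ->
      `|exp_coords y i - exp_coords x i| < e].
    apply: (@near_mem_seq _ _ x (enum 'I_n) (fun i y =>
      `|exp_coords y i - exp_coords x i| < e)) => i.
    have /cvgrPdist_lt/(_ e e0) : (fun y : 'rV[R]_n => expR (y 0 i)) @ x --> expR (x 0 i).
      apply: (@continuous_comp _ _ _ (fun M : 'rV[R]_n => M 0 i) (@expR R)).
        exact: coord_continuous.
      exact: continuous_expR.
    by apply: filterS => y; rewrite distrC.
  move=> /Bx[y [By ye]]; exists y => // i; apply: ye.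
  by rewrite mem_enum.
have /nbhs_ballP[d /= d0 dU] := Ux.
(* Moving x_i by at least d changes e^(x_i) by at least e^(x_i) (1 - e^(-d)), also upwards since e^d
   - 1 >= 1 - e^(-d); and x_i >= -|x|. *)
pose e := expR (- `|x|) * (1 - expR (- d)).
have e0 : 0 < e by rewrite mulr_gt0 ?expR_gt0 // subr_gt0 expR_lt1 oppr_lt0.
have [y By ye] := H e e0; exists y; split=> //; apply: dU.
apply/rV_ballP; split=> // i; rewrite ltNge; apply/negP => dxy.
have := ye i; apply/negP; rewrite -leNgt /exp_coords.
have xe : e <= expR (x 0 i) * (1 - expR (- d)).
  rewrite /e ler_wpM2r //; first by rewrite subr_ge0 ltW // expR_lt1 oppr_lt0.
  rewrite ler_expR lerNl; apply: le_trans (ler_norm _) _; rewrite normrN.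
  have := @mx_normrE R 1 n x; rewrite [in leRHS]/Num.norm /= => ->.
  by apply/bigmax_geP; right => /=; exists (0, i).
apply: le_trans xe _.
have x0 := expR_gt0 (x 0 i).
have [xy|xy] := leP (x 0 i) (y 0 i).
  rewrite ger0_norm ?subr_ge0 ?ler_expR //.
  have xd : x 0 i + d <= y 0 i by move: dxy; rewrite ler0_norm ?subr_le0 //; lra.
  have h : expR (x 0 i) * expR d <= expR (y 0 i) by rewrite -expRD ler_expR.
  have h2 : 2 <= expR d + expR (- d).
    have := mulr_ge0 (expR_ge0 (- d)) (sqr_ge0 (expR d - 1)).
    have -> : expR (- d) * (expR d - 1) ^+ 2 = expR d * (expR d * expR (- d)) -
        2 * (expR d * expR (- d)) + expR (- d) by ring.
    by rewrite expRxMexpNx_1; lra.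
  apply: (@le_trans _ _ (expR (x 0 i) * (expR d - 1))).
    by rewrite ler_pM2l //; lra.
  by rewrite mulrBr mulr1 lerB.
rewrite ler0_norm ?subr_le0 ?ler_expR ?(ltW xy) //.
have xd : y 0 i <= x 0 i - d by move: dxy; rewrite gtr0_norm ?subr_gt0 //; lra.
have h : expR (y 0 i) <= expR (x 0 i) * expR (- d) by rewrite -expRD ler_expR.
by rewrite mulrBr mulr1 opprB lerB.
Qed.

Definition zpoly_deg f : nat :=
  (\sum_(a <- finsupp f) \sum_(i < n) `|(a 0 i)%R|)%N.

(* f times a monomial clearing the negative exponents *)
Definition zpoly f (z : 'I_n -> R[i]) : R[i] :=
  \sum_(a <- finsupp f) f a *
    \prod_(i < n) z i ^+ `|(a 0 i + (zpoly_deg f)%:Z)%R|%N.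

Lemma zpolyE f (z : 'I_n -> R[i]) : (forall i, z i != 0) ->
  zpoly f z = \prod_(i < n) z i ^+ zpoly_deg f * laurent_eval f (\row_i z i).
Proof.
move=> z0; rewrite mulr_sumr; apply: eq_big_seq => a af; rewrite mulrCA; congr (_ * _).
rewrite -big_split; apply: eq_bigr => i _ /=; rewrite mxE.
have aN : (`|(a 0 i)%R| <= zpoly_deg f)%N.
  rewrite /zpoly_deg (big_fsetD1 a) //= (bigD1 i) //= -addnA.
  exact: leq_addr.
have E : (`|(a 0 i + (zpoly_deg f)%:Z)%R|%N)%:Z = a 0 i + (zpoly_deg f)%:Z.
  by rewrite gez0_abs //; move: aN; move: (a 0 i) (zpoly_deg f) => u w; lia.
by rewrite exprnP E expfzDr // mulrC -exprnP.
Qed.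

(** For positive r this is the image of the amoeba under exp. Moduli enter squared to keep the
    condition polynomial. *)
Definition exp_amoeba f r := exists p q,
  (forall i, p i * p i + q i * q i = r i * r i) /\
  zpoly f (fun i => (p i +i* q i)%C) = 0.

Lemma exp_amoebaP f x : exp_amoeba f (exp_coords x) <-> amoeba f x.
Proof.
have ex0 i := expR_gt0 (x 0 i).
split=> [[p [q [pq fz]]]|/amoebaP[z xz fz]].
  pose z : 'rV[R[i]]_n := \row_i (p i +i* q i)%C.
  have xz : fiber x z.
    move=> i; rewrite mxE normc_def /= !expr2 pq -expr2 sqrtr_sqr.
    by rewrite /exp_coords gtr0_norm.
  have z0 i : (p i +i* q i)%C != 0 by have := fiber_torus xz i; rewrite mxE.
  apply/amoebaP; exists z => //; move: fz; rewrite zpolyE // => /eqP.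
  rewrite mulf_eq0 => /orP[|/eqP//].
  by rewrite prodf_seq_eq0 => /hasP[i _]; rewrite expf_eq0 (negbTE (z0 i)) andbF.
exists (fun i => complex.Re (z 0 i)), (fun i => complex.Im (z 0 i)); split.
  move=> i; apply: (@complexI R); rewrite -!expr2 add_Re2_Im2 xz.
  by rewrite -rmorphXn.
have -> : (fun i => (complex.Re (z 0 i) +i* complex.Im (z 0 i))%C) = (fun i => z 0 i).
  by apply/funext => i; case: (z 0 i).
rewrite zpolyE; last by move=> i; exact: (fiber_torus xz i).
have -> : \row_i z 0 i = z by apply/rowP => i; rewrite mxE.
by rewrite fz mulr0.
Qed.

(** Closure relative to the positive orthant, with two one-sided inequalities in place of an
    absolute value, ready for a first-order formula. *)
Definition exp_closure (B : ('I_n -> R) -> Prop) r := forall e, 0 < e ->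
  exists v, [/\ forall i, 0 < v i, forall i, v i - r i < e,
    forall i, r i - v i < e & B v].

Lemma closure_exp_coords (B : set 'rV[R]_n) (B' : ('I_n -> R) -> Prop) x :
  (forall y, B' (exp_coords y) <-> B y) ->
  closure B x <-> exp_closure B' (exp_coords x).
Proof.
move=> BB'; rewrite closure_exp; split=> H e /H.
  move=> [y By ye]; exists (exp_coords y); split; last exact/BB'.
  - by move=> i; exact: expR_gt0.
  - by move=> i; have := ye i; rewrite ltr_norml => /andP[].
  - by move=> i; have := ye i; rewrite ltr_norml => /andP[]; lra.
move=> [v [v0 vr rv Bv]]; have [y yv] := exp_coordsP v0.
exists y; first by apply/BB'; rewrite yv.
by move=> i; rewrite yv ltr_norml; have := vr i; have := rv i; lra.
Qed.

Lemma boundary_exp_coords f x : boundary (amoeba f) x <->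
  exp_closure (exp_amoeba f) (exp_coords x) /\
  exp_closure (fun r => ~ exp_amoeba f r) (exp_coords x).
Proof.
rewrite -(closure_exp_coords x (exp_amoebaP f)).
rewrite -(closure_exp_coords (B := ~` amoeba f) x); last first.
  by move=> y; rewrite exp_amoebaP.
by rewrite /boundary closure_setC.
Qed.

Definition on_block k (e : nat -> R) : 'I_n -> R := fun i => e (bvar k i).

Lemma on_block_bupd e k v : on_block k (bupd e k v) = v.
Proof. by apply/funext => i; rewrite /on_block bupdE eqxx. Qed.

Lemma on_block_bupdN e k k' v : k' != k -> on_block k (bupd e k' v) = on_block k e.
Proof. by move=> kk; apply/funext => i; rewrite /on_block bupdE (negbTE kk). Qed.

Lemma on_block_upd e k m t : (m < 2)%N ->
  on_block k (env_upd e m t) = on_block k e.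
Proof.
move=> m2; apply/funext => i; rewrite /on_block /env_upd; case: eqP => // h.
by move: m2; rewrite -h.
Qed.

Lemma definable_exp_amoeba f :
  definable (fun e => exp_amoeba f (on_block 1 e)).
Proof.
pose P (e : nat -> R) := (forall i, on_block 2 e i * on_block 2 e i +
    on_block 3 e i * on_block 3 e i = on_block 1 e i * on_block 1 e i) /\
  zpoly f (fun i => (on_block 2 e i +i* on_block 3 e i)%C) = 0.
have dP : definable P.
  apply: definable_and.
    apply: definable_forall_ord => i; apply: definable_eq.
      by apply: poly_funD; apply: poly_funM; exact: poly_fun_var.
    by apply: poly_funM; exact: poly_fun_var.
  apply: definable_ceq0; apply: cpoly_fun_sum => a; apply: cpoly_funM.
    exact: cpoly_fun_cst.
  apply: cpoly_fun_prod => i; apply: cpoly_funXn.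
  by split; exact: poly_fun_var.
apply: definable_ext (definable_bex n 2 (definable_bex n 3 dP)) => e; split.
  move=> [p [q []]]; rewrite !(on_block_bupd, on_block_bupdN) // => pq fz.
  by exists p, q.
move=> [p [q [pq fz]]]; exists p, q; split;
  by rewrite !(on_block_bupd, on_block_bupdN).
Qed.

Lemma definable_exp_closure (B : ('I_n -> R) -> Prop) :
  definable (fun e => B (on_block 1 e)) ->
  definable (fun e => exp_closure B (on_block 0 e)).
Proof.
move=> dB.
pose Q (e : nat -> R) := (forall i, 0 < on_block 1 e i) /\
  ((forall i, on_block 1 e i - on_block 0 e i < e 1%N) /\
  ((forall i, on_block 0 e i - on_block 1 e i < e 1%N) /\ B (on_block 1 e))).
have dQ : definable Q.
  apply: definable_and.
    apply: definable_forall_ord => i; apply: definable_lt.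
      exact: poly_fun_cst.
    exact: poly_fun_var.
  apply: definable_and; last apply: definable_and => //.
    apply: definable_forall_ord => i; apply: definable_lt; last exact: poly_fun_var.
    by apply: poly_funB; exact: poly_fun_var.
  apply: definable_forall_ord => i; apply: definable_lt; last exact: poly_fun_var.
  by apply: poly_funB; exact: poly_fun_var.
have d1 : definable (fun e : nat -> R => 0 < e 1%N).
  by apply: definable_lt; [exact: poly_fun_cst|exact: poly_fun_var].
apply: definable_ext (definable_all 1 (definable_imp d1 (definable_bex n 1 dQ))).
move=> e; split=> H t; have := H t; rewrite {1}/env_upd /=.
  move=> /[apply] -[v []]; rewrite on_block_bupd => v0 [].
  rewrite on_block_bupdN // on_block_upd // bupd_low // => vr [rv Bv].
  by exists v.
move=> /[apply] -[v [v0 vr rv Bv]]; exists v; rewrite /Q on_block_bupd.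
by rewrite on_block_bupdN // on_block_upd // bupd_low.
Qed.

Lemma finite_boundary_intersection (F : 'I_n -> laurent R n) :
  generic F -> finite_set (boundary_intersection F).
Proof.
move=> [_ gcodim _].
have [->|/set0P V0] := eqVneq (boundary_intersection F) set0; first exact: finite_set0.
have [v _] := V0.
(* The codimension condition speaks of non-empty index sets only; for n = 0 the space is a single
   point. *)
have [n0|n0] := posnP n.
  apply: (@sub_finite_set _ _ [set v]); last exact: finite_set1.
  by move=> x _ /=; apply/rowP => i; move: (ltn_ord i); rewrite {2}n0.
have dV : hausdorff_dim (boundary_intersection F) = 0%E.
  have := gcodim [set: 'I_n]%SET; rewrite finset.cardsT card_ord => /(_ n0).
  have -> : \bigcap_(j in [set` [set: 'I_n]%SET]) boundary (amoeba (F j)) =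
      boundary_intersection F.
    by apply/seteqP; split=> y Hy j _; apply: Hy => //=; rewrite inE.
  by rewrite /has_codim subnn; exact.
apply: finite_coords => i.
pose P (e : nat -> R) := (forall j, 0 < on_block 0 e j) /\
  (on_block 0 e i = e 0%N /\ forall l,
    exp_closure (exp_amoeba (F l)) (on_block 0 e) /\
    exp_closure (fun r => ~ exp_amoeba (F l) r) (on_block 0 e)).
have dP : definable P.
  apply: definable_and.
    apply: definable_forall_ord => j; apply: definable_lt.
      exact: poly_fun_cst.
    exact: poly_fun_var.
  apply: definable_and; first by apply: definable_eq; exact: poly_fun_var.
  apply: definable_forall_ord => l; have dA := definable_exp_amoeba (F l).
  apply: definable_and; apply: definable_exp_closure => //.
  exact: definable_not.
have dQ := definable_bex n 0 dP.
have QE t : (exists r, P (bupd (nth 0 [:: t]) 0 r)) <->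
    exists2 x, boundary_intersection F x & expR (x 0 i) = t.
  split=> [[r []]|[x Vx xt]].
    rewrite on_block_bupd bupd_low //= => r0 [rt rV].
    have [x xr] := exp_coordsP r0; exists x; last by rewrite -rt -xr.
    by move=> l _; apply/boundary_exp_coords; rewrite xr; exact: rV.
  exists (exp_coords x); rewrite /P on_block_bupd bupd_low //=.
  split; first by move=> j; exact: expR_gt0.
  by split=> // l; apply/boundary_exp_coords; exact: Vx.
apply: contrapT => infV.
have [|a [b [ab abQ]]] := definable_line_infinite dQ.
  move=> finQ; apply: infV.
  apply: (@sub_finite_set _ _ (@ln R @` [set t | exists r, P (bupd (nth 0 [:: t]) 0 r)])).
    move=> _ [x Vx <-]; exists (expR (x 0 i)); last exact: expRK.
    by apply/QE; exists x.
  exact: finite_image.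
have ex_ab t : a <= t <= b -> exists2 x, boundary_intersection F x & expR (x 0 i) = t.
  by move=> /abQ/QE.
have a0 : 0 < a.
  have [|x _ <-] := ex_ab a; first by rewrite lexx ltW.
  exact: expR_gt0.
have b0 : 0 < b by exact: lt_trans ab.
apply: (@hausdorff_dim0_coord R n _ i (ln a) (ln b) V0 dV).
  by rewrite ltr_ln ?posrE.
move=> t; rewrite /= in_itv /= => /andP[at_ tb].
have [|x Vx xt] := ex_ab (expR t).
  have la : expR (ln a) = a by rewrite lnK // posrE.
  have lb : expR (ln b) = b by rewrite lnK // posrE.
  by rewrite -[X in X <= _ <= _]la -[X in _ <= _ <= X]lb !ler_expR at_ tb.
by exists x => //; exact: expR_inj.
Qed.

End ExpCoordinates.

(** * Segments inside a component *)

Section LocalStructure.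
Variables (R : realType) (n : nat).
Implicit Types (f : laurent R n) (x y p c v : 'rV[R]_n).

(** By uniqueness, the points of the complement near p lie in one component, which is open, convex
    and misses p; a hyperplane through p avoiding it lies in the amoeba near p. The value c = 0
    encodes an interior point, where the hyperplane becomes the whole space. *)
Lemma amoeba_contains_hyperplane f p : amoeba f p ->
  (boundary (amoeba f) p ->
    exists! E, is_component (~` amoeba f) E /\ closure E p) ->
  exists c, (~ boundary (amoeba f) p -> c = 0) /\
    \forall x \near p, vdot c (x - p) = 0 -> amoeba f x.
Proof.
move=> fp uniqE.
have [bp|nbp] := pselect (boundary (amoeba f) p); last first.
  exists 0; split=> //.
  have ip : (amoeba f)° p.
    apply: contrapT => ip; apply: nbp; split=> //; exact: subset_closure.
  by apply: filterS ip => x fx _.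
have [E [[cE pE] uE]] := uniqE bp.
have nE : \forall x \near p, ~ amoeba f x -> E x.
  by apply: near_unique_component => // E' cE' pE'; apply/esym/uE.
have [x0 fx0 EE] := cE.
have [||||c c0 cP] := @open_convex_supporting R n E p.
- by rewrite EE; exact: component_amoebaC_convex.
- by rewrite EE; exact: component_amoebaC_open.
- by exists x0; rewrite EE; exact: connected_component_refl.
- by rewrite EE => /connected_component_sub; exact.
exists c; split=> [/(_ bp)//|]; apply: filterS nE => x fxE cx.
by apply: contrapT => /fxE; exact: cP.
Qed.

(** A zero column makes the square matrix of the c j singular, and v is taken in its left kernel. *)
Lemma common_orthogonal (c : 'I_n -> 'rV[R]_n) l : c l = 0 ->
  exists2 v, v != 0 & forall j, vdot (c j) v = 0.
Proof.
move=> cl; pose M : 'M[R]_n := \matrix_(i, j) c j 0 i.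
have rM : (\rank M < n)%N.
  rewrite ltn_neqAle rank_leq_row andbT; apply/negP => /eqP rM.
  have uM : M \in unitmx by rewrite -row_free_unit /row_free rM.
  have : col l M = 0 by apply/colP => i; rewrite !mxE cl mxE.
  rewrite colE => /(congr1 (mulmx (invmx M))); rewrite mulKmx // mulmx0.
  by move/colP/(_ l); rewrite !mxE !eqxx => /eqP; rewrite oner_eq0.
have /rowV0Pn[v vK v0] : kermx M != 0.
  by rewrite -mxrank_eq0 mxrank_ker -lt0n subn_gt0.
exists v => // j; move/sub_kermxP: vK => /rowP/(_ j); rewrite !mxE => vM.
rewrite -[RHS]vM; apply: eq_bigr => i _; by rewrite !mxE mulrC.
Qed.

Variable F : 'I_n -> laurent R n.
Hypothesis gF : generic F.

Lemma component_segment K p : is_component (amoeba_intersection F) K ->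
  K p -> ~ boundary_intersection F p ->
  exists2 v, v != 0 & K (p + v) /\ K (p - v).
Proof.
move=> [x0 Ix0 ->] Kp Vp; set I := amoeba_intersection F.
have Ip : I p by exact: connected_component_sub Kp.
have [l nl] : exists l, ~ boundary (amoeba (F l)) p.
  by apply: contrapT => /forallNP nl; apply: Vp => j _; exact: contrapT (nl j).
have [_ _ g3] := gF.
have /choice[c cP] : forall j, exists c,
    (~ boundary (amoeba (F j)) p -> c = 0) /\
    \forall x \near p, vdot c (x - p) = 0 -> amoeba (F j) x.
  move=> j; apply: amoeba_contains_hyperplane; first exact: Ip.
  exact: g3.
have [v v0 cv] := common_orthogonal ((cP l).1 nl).
have : \forall x \near p, forall j, j \in enum 'I_n ->
    vdot (c j) (x - p) = 0 -> amoeba (F j) x.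
  by apply: near_mem_seq => j; exact: (cP j).2.
move=> near_p.
have cl : (fun s : R => p + s *: v) @ 0 --> p by exact: cvg_line.
have /nbhs_ballP[e /= e0 He] := cl _ near_p.
have e20 : 0 < e / 2 by rewrite divr_gt0.
have seg s : `|s| <= e / 2 -> I (p + s *: v).
  move=> se j _; apply: (He s) => //=; last by rewrite addrAC subrr add0r vdotZr cv mulr0.
    by rewrite /ball /= sub0r normrN (le_lt_trans se) // ltr_pdivrMr // ltr_pMr // ltr1n.
  by rewrite mem_enum.
pose g (s : R) := p + s *: v.
(* The segment is connected and passes through p, so it stays in the component of p. *)
have Kg s : `|s| <= e / 2 -> connected_component I x0 (p + s *: v).
  move=> se; apply: (connected_component_trans Kp).
  apply: (@connected_component_max _ _ (g @` `[- (e / 2), e / 2]%classic)).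
  - by exists 0; rewrite /g ?scale0r ?addr0 //= in_itv /= oppr_le0 ltW //= ltW.
  - move=> _ [u uI <-]; apply: seg; move: uI; rewrite /= in_itv /= => uI.
    by rewrite ler_norml.
  - apply: connected_continuous_connected; first exact: segment_connected.
    apply: continuous_subspaceT => u; apply: cvgD; first exact: cvg_cst.
    by apply: cvgZr_tmp; exact: cvg_id.
  by exists s => //=; rewrite in_itv /= -ler_norml.
exists ((e / 2) *: v); first by rewrite scaler_eq0 negb_or v0 gt_eqF.
split; first by apply: Kg; rewrite gtr0_norm.
by rewrite -scaleNr; apply: Kg; rewrite normrN gtr0_norm.
Qed.

End LocalStructure.

(* Maximise a small strictly convex perturbation of a separating functional:
   a maximiser is never the midpoint of a segment in K. *)
Lemma compact_sub_convex_hull (R : realType) n (K : set 'rV[R]_n)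
    (s : seq 'rV[R]_n) : compact K ->
  (forall p, K p -> p \notin s ->
    exists2 v, v != 0 & K (p + v) /\ K (p - v)) ->
  K `<=` convex_hull [set` s].
Proof.
move=> cK segK x Kx; apply: contrapT => nx.
have [c0 c0P] := finite_separation nx; pose c := - c0.
have cP v : v \in s -> vdot c v < vdot c x.
  by move=> vs; rewrite !vdotNl ltrN2; exact: c0P.
pose phi (e : R) y := vdot c y + e * vdot y y.
have [e e0 eP] : exists2 e, 0 < e & forall v, v \in s -> phi e v < phi e x.
  elim: s cP {segK nx c0P} => [_|v s IH cP]; first by exists 1.
  have [w ws|e e0 eP] := IH; first by apply: cP; rewrite inE ws orbT.
  (* This makes [phi d v] equal to <c, x> - d, which is below [phi d x]. *)
  pose d := (vdot c x - vdot c v) / (1 + vdot v v).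
  have v1 : 0 < 1 + vdot v v by rewrite ltr_wpDr // vdot_ge0.
  have d0 : 0 < d by rewrite divr_gt0 // subr_gt0 cP // mem_head.
  (* The difference of the two sides is affine in the weight and has the right sign at weights 0 and
     b, hence at a in between; so the minimum over all of s can be taken. *)
  have le_phi (a b : R) w : 0 < a -> a <= b -> vdot c w < vdot c x ->
      phi b w < phi b x -> phi a w < phi a x.
    move=> a0 ab wx; rewrite /phi => wb.
    have [le|lt] := leP (vdot w w) (vdot x x).
      by apply: ltr_leD => //; rewrite ler_wpM2l // ltW.
    have : a * (vdot w w - vdot x x) <= b * (vdot w w - vdot x x).
      by rewrite ler_wpM2r // subr_ge0 ltW.
    by rewrite !mulrBr; lra.
  have de0 : 0 < Num.min d e by rewrite lt_min d0 e0.
  exists (Num.min d e) => // w; rewrite inE => /orP[/eqP ->|ws]; last first.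
    apply: (@le_phi _ e) => //; first by rewrite ge_min lexx orbT.
      by apply: cP; rewrite inE ws orbT.
    exact: eP.
  apply: (@le_phi _ d) => //; [by rewrite ge_min lexx|by apply: cP; exact: mem_head|].
  have : d * (1 + vdot v v) = vdot c x - vdot c v by rewrite /d divfK // gt_eqF.
  have : 0 <= d * vdot x x by rewrite mulr_ge0 ?vdot_ge0 // ltW.
  by rewrite /phi mulrDr mulr1; lra.
have cphi : continuous (phi e).
  move=> y; have idy : (fun z : 'rV[R]_n => z) @ nbhs y --> y by [].
  apply: (@cvgD _ _ _ (nbhs y)).
    apply: (@cvg_vdot R n _ (nbhs y) (fun=> c) (fun z => z) c y (@nbhs_filter _ y) _ idy).
    exact: (@cst_continuous _ _ c y).
  apply: (@cvgM _ _ (nbhs y)).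
    exact: (@cst_continuous _ _ e y).
  exact: (@cvg_vdot R n _ (nbhs y) (fun z => z) (fun z => z) y y (@nbhs_filter _ y) idy idy).
have [||p] := @EVT_max_rV R n (phi e) K _ cK; first by exists x.
  exact: continuous_subspaceT.
rewrite inE => Kp pmax.
have px : phi e x <= phi e p by apply: pmax; rewrite inE.
have ps : p \notin s.
  by apply/negP => /eP; rewrite ltNge px.
have [v v0 [Kv1 Kv2]] := segK p Kp ps.
have := pmax (p + v); have := pmax (p - v); rewrite !inE => /(_ Kv2) h2 /(_ Kv1) h1.
have vv := vdot_gt0 v0.
(* Parallelogram identity: the mean of the values at p + v and p - v exceeds the maximum
   [phi e p]. *)
have : phi e (p + v) + phi e (p - v) = 2 * phi e p + 2 * (e * vdot v v).
  rewrite /phi !(vdotDr c) (vdotNr c).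
  have := vdot_sqrD p v 1; have := vdot_sqrD p v (- 1).
  by rewrite !scaleN1r !scale1r => -> ->; ring.
have : 0 < e * vdot v v by rewrite mulr_gt0.
by lra.
Qed.

Theorem theorem3p7 (R : realType) (n : nat) (hn : (2 <= n)%N)
  (A : 'I_n -> {fset 'rV[int]_n}) (F : 'I_n -> laurent R n)
  (hA : forall j : 'I_n, finsupp (F j) = A j)
  (hgen : generic F)
  (hcompact : compact (amoeba_intersection F))
  (K : set 'rV[R]_n) (hK : is_component (amoeba_intersection F) K) :
  vertices (intersection_polytope F K) = extreme_points (convex_hull K) /\
  convex_hull K = intersection_polytope F K.
Proof.
(* A component of a closed set is closed. *)
have cK : compact K.
  have [x0 Ix0 KE] := hK.
  have cI : closed (amoeba_intersection F).
    by apply: compact_closed hcompact; exact: norm_hausdorff.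
  rewrite KE; apply: (subclosed_compact _ hcompact).
    exact: component_closed.
  exact: connected_component_sub.
have [s sE] : exists s : seq 'rV[R]_n, K `&` boundary_intersection F = [set` s].
  apply/finite_seqP; apply: sub_finite_set (finite_boundary_intersection hgen).
  by move=> x [].
have PE : intersection_polytope F K = convex_hull [set` s].
  by rewrite /intersection_polytope sE.
have KP : K `<=` convex_hull [set` s].
  apply: compact_sub_convex_hull => // p Kp ps.
  apply: (component_segment hgen hK) => // Vp; move/negP: ps; apply.
  suff : [set` s] p by [].
  by rewrite -sE.
have hullE : convex_hull K = convex_hull [set` s].
  apply/seteqP; split; apply: convex_hull_min; try exact: convex_hull_convex.
    exact: KP.
  by rewrite -sE => x [Kx _]; exact: sub_convex_hull.
by rewrite PE hullE vertices_convex_hull_finite.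
Qed.
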